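(* Let $n\ge 1$ be an integer, let $r>0$, and let $p\in[1,\infty]$. Let $B\in\mathbb{R}^{n\times n}$ be symmetric, $g\in\mathbb{R}^n$, $c\in\mathbb{R}$, and let $Q(x)=\frac12 x^{\mathrm T}Bx+g^{\mathrm T}x+c$ for $x\in\mathbb{R}^n$. Let $D$ be the diagonal part of $B$. Then $$\|Q\|^2_{H^0(\mathcal{B}_p^r)}=\frac{I}{2}\|B\|_{\mathrm F}^2+\frac{I}{4}(\mathrm{Tr}\,B)^2+\frac{J-3I}{4}\|D\|_{\mathrm F}^2+K\left(c\,\mathrm{Tr}\,B+\|g\|_2^2\right)+Vc^2$$ and $$|Q|^2_{H^1(\mathcal{B}_p^r)}=K\|B\|_{\mathrm F}^2+V\|g\|_2^2,$$ where $$I=\frac{[\Gamma(\frac{3}{p})]^2\,\Gamma(\frac{n}{p})}{[\Gamma(\frac{1}{p})]^2\,\Gamma(\frac{n+4}{p})}\cdot\frac{n}{n+4}\cdot V_p\,r^{n+4},\qquad J=\frac{\Gamma(\frac{5}{p})\,\Gamma(\frac{n}{p})}{\Gamma(\frac{1}{p})\,\Gamma(\frac{n+4}{p})}\cdot\frac{n}{n+4}\cdot V_p\,r^{n+4},$$ $$K=\frac{\Gamma(\frac{3}{p})\,\Gamma(\frac{n}{p})}{\Gamma(\frac{1}{p})\,\Gamma(\frac{n+2}{p})}\cdot\frac{n}{n+2}\cdot V_p\,r^{n+2},\qquad V=V_p\,r^n.$$ When $p=\infty$, the expressions for $I$, $J$, $K$ are interpreted in the sense of limits: $V_p$ is $V_\infty$,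 and each quotient of Gamma function values is replaced by its limit as $p\to\infty$ through finite values.
   Context: $\|\cdot\|_p$ is the $\ell_p$-norm on $\mathbb{R}^n$ ($1\le p\le\infty$), $\mathcal{B}_p^r=\{x\in\mathbb{R}^n : \|x\|_p\le r\}$, and $V_p$ is the volume (Lebesgue measure) of $\mathcal{B}_p^1$. $\Gamma$ is the Gamma function, $\|\cdot\|_{\mathrm F}$ the Frobenius norm, $\mathrm{Tr}$ the trace. The diagonal part $D\in\mathbb{R}^{n\times n}$ of $B$ is the diagonal matrix with the same diagonal entries as $B$. For a function $f$ on a domain $\Omega\subset\mathbb{R}^n$, $\|f\|_{H^0(\Omega)}=\left[\int_\Omega |f(x)|^2\,\mathrm{d}x\right]^{1/2}$ and $|f|_{H^1(\Omega)}=\left[\int_\Omega\|\nabla f(x)\|_2^2\,\mathrm{d}x\right]^{1/2}$. *)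

(* Defs.v *)
From HB Require Import structures.
From mathcomp Require Import all_boot all_order all_algebra.
From mathcomp Require Import all_classical all_reals all_analysis.
Set Implicit Arguments.
Unset Strict Implicit.
Unset Printing Implicit Defensive.
Import Order.TTheory GRing.Theory Num.Theory.
Import numFieldNormedType.Exports.
Local Open Scope classical_set_scope.
Local Open Scope ring_scope.

(* Lebesgue measure on R^n is built on n.-tuple R, which the library equips
   with the product sigma-algebra, as an n-fold product of the one-dimensional
   Lebesgue measure, and then transported to the column vectors 'cV[R]_n.
   Lemma lebesgue_cV_box below states that it gives boxes the expected value. *)

Lemma sigma_finite_pushforward (d1 d2 : measure_display)
    (T1 : measurableType d1) (T2 : measurableType d2) (R : realType)
    (m : set T1 -> \bar R) (f : T1 -> T2) (g : T2 -> T1) :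
  measurable_fun [set: T2] g -> cancel f g ->
  sigma_finite [set: T1] m -> sigma_finite [set: T2] (pushforward m f).
Proof.
move=> mg fK [F FT Foo].
exists (fun k => g @^-1` F k); first by rewrite -preimage_bigcup -FT.
move=> k; have [mF Fk] := Foo k; split.
  by rewrite -[X in measurable X]setTI; exact: mg.
rewrite /pushforward -comp_preimage.
by rewrite (_ : g \o f = id) ?preimage_id//; apply/funext => x /=.
Qed.

Lemma sigma_finite_product (d1 d2 : measure_display)
    (T1 : measurableType d1) (T2 : measurableType d2) (R : realType)
    (m1 : {sigma_finite_measure set T1 -> \bar R})
    (m2 : {sigma_finite_measure set T2 -> \bar R}) :
  sigma_finite [set: T1 * T2] (m1 \x m2)%E.
Proof.
have /sigma_finiteP[F [TF ndF Foo]] := sigma_finiteT m1.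
have /sigma_finiteP[G [TG ndG Goo]] := sigma_finiteT m2.
exists (fun k => F k `*` G k).
  apply/seteqP; split => // -[x y] _.
  have [i _ Fix] : (\bigcup_k F k) x by rewrite -TF.
  have [j _ Gjy] : (\bigcup_k G k) y by rewrite -TG.
  exists (maxn i j) => //; split.
    exact: (subsetPset _ _ (ndF _ _ (leq_maxl i j))).
  exact: (subsetPset _ _ (ndG _ _ (leq_maxr i j))).
move=> k; have [mF Fk] := Foo k; have [mG Gk] := Goo k; split.
  exact: measurableX.
by rewrite product_measure1E// lte_mul_pinfty// ge0_fin_numE.
Qed.

Section lebesgue_tuple.
Context {R : realType}.
Local Notation RM := (measurableTypeR R).

Definition tuple_cons n (x : RM * n.-tuple RM) : n.+1.-tuple RM :=
  [tuple of x.1 :: x.2].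

Definition tuple_uncons n (t : n.+1.-tuple RM) : RM * n.-tuple RM :=
  (thead t, [tuple of behead t]).

Lemma tuple_consK n : cancel (@tuple_cons n) (@tuple_uncons n).
Proof. by move=> [x t]; congr pair; apply/val_inj. Qed.

Lemma measurable_tuple_cons n : measurable_fun setT (@tuple_cons n).
Proof. exact: measurable_cons. Qed.

Lemma measurable_tuple_uncons n : measurable_fun setT (@tuple_uncons n).
Proof.
apply/measurable_fun_pair; first exact: measurable_tnth.
exact: measurable_behead.
Qed.

Section step.
Variables (n : nat) (m : {sigma_finite_measure set n.-tuple RM -> \bar R}).

Definition lebesgue_tupleS : set (n.+1.-tuple RM) -> \bar R :=
  pushforward (@lebesgue_measure R \x m)%E (@tuple_cons n).

Let lebesgue_tupleS0 : lebesgue_tupleS set0 = 0%E.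
Proof. by rewrite /lebesgue_tupleS /pushforward preimage_set0 measure0. Qed.

Let lebesgue_tupleS_ge0 A : (0 <= lebesgue_tupleS A)%E.
Proof. by rewrite /lebesgue_tupleS /pushforward measure_ge0. Qed.

Let lebesgue_tupleS_sigma_additive : semi_sigma_additive lebesgue_tupleS.
Proof.
apply: measure_semi_sigma_additive; exact: measurable_tuple_cons.
Qed.

HB.instance Definition _ := isMeasure.Build _ _ _ lebesgue_tupleS
  lebesgue_tupleS0 lebesgue_tupleS_ge0 lebesgue_tupleS_sigma_additive.

Let lebesgue_tupleS_sigma_finite : sigma_finite setT lebesgue_tupleS.
Proof.
apply: (sigma_finite_pushforward (@measurable_tuple_uncons n)
  (@tuple_consK n)).
exact: sigma_finite_product.
Qed.

HB.instance Definition _ := @Measure_isSigmaFinite.Build _ _ _ lebesgue_tupleS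
  lebesgue_tupleS_sigma_finite.
End step.

Fixpoint lebesgue_tuple n : {sigma_finite_measure set n.-tuple RM -> \bar R} :=
  if n is k.+1 then lebesgue_tupleS (lebesgue_tuple k)
  else dirac [tuple].

Lemma lebesgue_tuple_box n (A : 'I_n -> set RM) :
  (forall i, measurable (A i)) ->
  lebesgue_tuple n [set t | forall i, A i (tnth t i)] =
  (\big[*%E/1]_(i < n) lebesgue_measure (A i))%E.
Proof.
elim: n A => [|n IH] A mA.
  rewrite big_ord0 /= diracE mem_set//= => -[]//.
set B := [set t : n.-tuple RM | forall i, A (lift ord0 i) (tnth t i)].
have mB : measurable B.
  rewrite (_ : B = \big[setI/setT]_(i <- index_enum 'I_n)
      ((fun t : n.-tuple RM => tnth t i) @^-1` A (lift ord0 i))).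
    apply: bigsetI_measurable => i _.
    by rewrite -[X in measurable X]setTI; exact: measurable_tnth.
  rewrite -bigcap_seq; apply/seteqP; split => [t Bt i _|t Bt i]; first exact: Bt.
  by apply: Bt; rewrite /= mem_index_enum.
rewrite big_ord_recl -IH//= -product_measure1E// /lebesgue_tupleS /pushforward.
congr (_ _); apply/seteqP; split => [[x t] At|[x t] [Ax Bt] i].
  split => /=; first exact: (At ord0).
  by move=> i; have := At (lift ord0 i); rewrite /= tnthS.
by case: (unliftP ord0 i) => [j ->|->//]; rewrite /= tnthS; exact: Bt.
Qed.
End lebesgue_tuple.

Definition cV_display : measure_display.
Proof. exact: default_measure_display. Qed.

Section lebesgue_cV.
Context {R : realType} (n : nat).
Local Notation RM := (measurableTypeR R).

Definition cV_coord (i : 'I_n) (x : 'cV[R]_n) : RM := x i ord0.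

Definition tuple_of_cV (x : 'cV[R]_n) : n.-tuple RM :=
  [tuple cV_coord i x | i < n].

Definition cV_of_tuple (t : n.-tuple RM) : 'cV[R]_n := \col_i tnth t i.

Lemma cV_of_tupleK : cancel cV_of_tuple tuple_of_cV.
Proof.
by move=> t; apply: eq_from_tnth => i; rewrite tnth_mktuple /cV_coord mxE.
Qed.

Lemma tuple_of_cVK : cancel tuple_of_cV cV_of_tuple.
Proof.
by move=> x; apply/colP => i; rewrite mxE tnth_mktuple.
Qed.

HB.instance Definition _ := @isMeasurable.Build
  cV_display 'cV[R]_n
  (g_sigma_preimage cV_coord) (@sigma_algebra0 _ _ _)
  (@sigma_algebraC _ _) (@sigma_algebra_bigcup _ _ _).

Lemma measurable_cV_of_tuple : measurable_fun [set: n.-tuple RM] cV_of_tuple.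
Proof.
have coordE : cV_coord = (fun i => (@tnth n RM ^~ i) \o tuple_of_cV).
  by apply/funext => i; apply/funext => x /=; rewrite tnth_mktuple.
move=> _ A; rewrite /measurable /= coordE g_sigma_preimage_comp => -[B mB <-].
by rewrite !setTI -comp_preimage (_ : _ \o _ = id)// funeqE => t; exact: cV_of_tupleK.
Qed.

Lemma measurable_tuple_of_cV : measurable_fun [set: 'cV[R]_n] tuple_of_cV.
Proof.
apply/measurable_fun_tnthP => i _ A mA; rewrite setTI.
apply: sub_sigma_algebra; rewrite -bigcup_seq/=.
exists i => /=; first by rewrite mem_index_enum.
by exists A => //; rewrite setTI; congr (_ @^-1` A); apply/funext => x; rewrite /= tnth_mktuple.
Qed.

Definition lebesgue_cV : set 'cV[R]_n -> \bar R :=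
  pushforward (lebesgue_tuple n) cV_of_tuple.

Let lebesgue_cV0 : lebesgue_cV set0 = 0%E.
Proof. by rewrite /lebesgue_cV /pushforward preimage_set0 measure0. Qed.

Let lebesgue_cV_ge0 A : (0 <= lebesgue_cV A)%E.
Proof. by rewrite /lebesgue_cV /pushforward measure_ge0. Qed.

Let lebesgue_cV_sigma_additive : semi_sigma_additive lebesgue_cV.
Proof.
apply: measure_semi_sigma_additive; exact: measurable_cV_of_tuple.
Qed.

HB.instance Definition _ := isMeasure.Build _ _ _ lebesgue_cV
  lebesgue_cV0 lebesgue_cV_ge0 lebesgue_cV_sigma_additive.

Let lebesgue_cV_sigma_finite : sigma_finite setT lebesgue_cV.
Proof.
apply: (sigma_finite_pushforward measurable_tuple_of_cV cV_of_tupleK).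
exact: sigma_finiteT.
Qed.

HB.instance Definition _ := @Measure_isSigmaFinite.Build _ _ _ lebesgue_cV
  lebesgue_cV_sigma_finite.

Lemma lebesgue_cV_box (a b : 'I_n -> R) : (forall i, a i <= b i) ->
  lebesgue_cV [set x | forall i, a i <= x i ord0 <= b i] =
  (\prod_(i < n) (b i - a i))%:E.
Proof.
move=> ab; rewrite -prodEFin.
transitivity (\big[*%E/1%E]_(i < n) @lebesgue_measure R `[a i, b i]); last first.
  apply: eq_bigr => i _; rewrite lebesgue_measure_itv/= lte_fin.
  by case: ltgtP (ab i) => // -> _; rewrite subrr.
rewrite -lebesgue_tuple_box; last by move=> i; exact: measurable_itv.
congr (lebesgue_tuple n _); apply/seteqP.
by split=> t /= At i; have := At i; rewrite mxE ?in_itv/=.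
Qed.
End lebesgue_cV.
Arguments lebesgue_cV {R n}.

Section function_norms.
Context {R : realType} (n : nat).

(* The exponent ranges over the extended reals; the value at -oo is junk. *)
Definition lp_norm (p : \bar R) (x : 'cV[R]_n) : R :=
  match p with
  | q%:E => (\sum_i `|x i ord0| `^ q) `^ q^-1
  | +oo%E => \big[Num.max/0]_i `|x i ord0|
  | -oo%E => 0
  end.

Definition lp_ball (p : \bar R) (r : R) : set 'cV[R]_n :=
  [set x | lp_norm p x <= r].

Definition lp_volume (p : \bar R) : R := fine (lebesgue_cV (lp_ball p 1)).

Definition gradient (f : 'cV[R]_n -> R) (x : 'cV[R]_n) : 'cV[R]_n :=
  \col_i 'D_(delta_mx i ord0) f x.

Definition H0_norm (Omega : set 'cV[R]_n) (f : 'cV[R]_n -> R) : \bar R :=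
  ((\int[lebesgue_cV]_(x in Omega) (`|f x| ^+ 2)%:E) `^ 2^-1)%E.

Definition H1_seminorm (Omega : set 'cV[R]_n) (f : 'cV[R]_n -> R) : \bar R :=
  ((\int[lebesgue_cV]_(x in Omega) (lp_norm 2%:E (gradient f x) ^+ 2)%:E)
     `^ 2^-1)%E.

Definition frobenius_norm (A : 'M[R]_n) : R :=
  Num.sqrt (\sum_i \sum_j A i j ^+ 2).

Definition diagonal_part (A : 'M[R]_n) : 'M[R]_n := diag_mx (\row_i A i i).

Definition quadratic (B : 'M[R]_n) (g : 'cV[R]_n) (c : R) (x : 'cV[R]_n) : R :=
  2^-1 * (x^T *m B *m x) ord0 ord0 + (g^T *m x) ord0 ord0 + c.

End function_norms.

Section gamma.
Context {R : realType}.

(* Meaningful for s > 0 only, where the integral converges. *)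
Definition Gamma (s : R) : R :=
  (\int[lebesgue_measure]_(t in `]0, +oo[) (t `^ (s - 1) * expR (- t)))%R.

(* The value at p of an expression in the exponent, at p = +oo its limit through
   finite values. *)
Definition at_exponent (F : R -> R) (p : \bar R) : R :=
  match p with
  | q%:E => F q
  | +oo%E => lim (F q @[q --> +oo])
  | -oo%E => 0
  end.

Variables (n : nat) (p : \bar R) (r : R).

Definition I_coef : R :=
  at_exponent (fun q => Gamma (3 / q) ^+ 2 * Gamma (n%:R / q) /
                        (Gamma (1 / q) ^+ 2 * Gamma ((n + 4)%:R / q))) p
  * (n%:R / (n + 4)%:R) * lp_volume n p * r ^+ (n + 4).

Definition J_coef : R :=
  at_exponent (fun q => Gamma (5 / q) * Gamma (n%:R / q) /
                        (Gamma (1 / q) * Gamma ((n + 4)%:R / q))) p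
  * (n%:R / (n + 4)%:R) * lp_volume n p * r ^+ (n + 4).

Definition K_coef : R :=
  at_exponent (fun q => Gamma (3 / q) * Gamma (n%:R / q) /
                        (Gamma (1 / q) * Gamma ((n + 2)%:R / q))) p
  * (n%:R / (n + 2)%:R) * lp_volume n p * r ^+ (n + 2).

Definition V_coef : R := lp_volume n p * r ^+ n.

End gamma.

(* Main.v *)
(**
For a finite exponent p the moments of the l_p-ball come from Dirichlet's trick.
Put N(x) = sum_i |x_i|^p and let f be a monomial in the |x_i| of total degree A.
Writing exp(-N(x)) as the integral of exp(-t) over t >= N(x) and applying
Tonelli, the integral of f exp(-N) over R^n is the integral over t > 0 of
exp(-t) times the integral of f over the ball of radius t^(1/p); by homogeneity
this is Gamma(1 + (n + A)/p) times the moment over the unit ball.  The same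
integral factors over the coordinates, and the one-dimensional factors are
evaluated by the same layer-cake identity, which also yields the functional
equation of Gamma.  For p = oo the ball is a cube, and the formulas agree
because Gamma(1 + s) -> 1 as s -> 0+.  Moments with an odd exponent vanish by
sign flips, so E[x_i x_j x_k x_l] is I (d_ij d_kl + d_ik d_jl + d_il d_jk)
+ (J - 3 I) d_ijkl with Kronecker deltas d, and expanding Q^2 and |grad Q|^2
gives the result.
*)
Require Import Defs.
From mathcomp Require Import all_boot all_order all_algebra.
From mathcomp Require Import ring lra.
From mathcomp Require Import all_classical all_reals all_analysis.
From mathcomp Require Import measurable_realfun.
Set Implicit Arguments.
Unset Strict Implicit.
Unset Printing Implicit Defensive.
Import Order.TTheory GRing.Theory Num.Theory.
Import numFieldNormedType.Exports.
Local Open Scope classical_set_scope.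
Local Open Scope ring_scope.

(** * Layer-cake identity and the Gamma function *)

Lemma integral_expRN (R : realType) (a : R) :
  (\int[lebesgue_measure]_(t in `[a, +oo[) (expR (- t))%:E = (expR (- a))%:E)%E.
Proof.
have d (x : R) : is_derive x 1 (fun t => - expR (- t)) (expR (- x)).
  by apply: is_derive_eq; rewrite /= mulrN1 opprK.
have cexp : continuous (fun t : R => expR (- t)).
  by move=> x; apply: continuous_comp; [exact: oppr_continuous|exact: continuous_expR].
rewrite (@ge0_continuous_FTC2y _ _ (fun t => - expR (- t)) _ 0)//.
- by rewrite sub0e EFinN oppeK.
- exact: continuous_subspaceT.
- by rewrite -oppr0; apply: cvgN; exact: cvgr_expR.
- by apply: cvgN; apply: cvg_at_right_filter; exact: cexp.
- by move=> x _; rewrite derive1E; exact: derive_val.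
Qed.

(** Tonelli on the region where [N x <= t]. The measure space is left abstract because the identity
    is applied twice: on the real line, to evaluate integrals of powers, and on R^n, to compute
    moments of balls. *)
Lemma layer_cake_expRN (R : realType) (d : measure_display)
    (T : measurableType d) (m : {sigma_finite_measure set T -> \bar R})
    (N : T -> R) (f : T -> \bar R) :
  measurable_fun setT N -> (forall x, 0 <= N x) ->
  measurable_fun setT f -> (forall x, 0 <= f x)%E ->
  (\int[m]_x (f x * (expR (- N x))%:E) =
   \int[lebesgue_measure]_(t in `]0%R, +oo[)
     ((expR (- t))%:E * \int[m]_(x in [set x | (N x <= t)%R]) f x))%E.
Proof.
move=> mN N0 mf f0.
pose S := [set z : T * measurableTypeR R | N z.1 <= z.2].
pose h (z : T * measurableTypeR R) : \bar R :=
  (f z.1 * (expR (- z.2) * \1_S z)%:E)%E.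
have mS : measurable S.
  rewrite -[X in measurable X]setTI.
  by apply: (@measurable_fun_ler _ _ _ setT (N \o fst) snd) => //; exact: measurableT_comp.
have mle t : measurable [set x | (N x <= t)%R].
  rewrite -[X in measurable X]setTI.
  by apply: (@measurable_fun_ler _ _ _ setT N (cst t)).
have mexp : measurable_fun setT (fun t : measurableTypeR R => expR (- t)).
  exact: measurableT_comp.
have h0 z : (0 <= h z)%E.
  by apply: mule_ge0 => //; rewrite lee_fin mulr_ge0 ?expR_ge0.
have mh : measurable_fun setT h.
  apply: emeasurable_funM; first exact: measurableT_comp.
  apply/measurable_EFinP/measurable_funM; last exact: measurable_indic.
  exact: (measurableT_comp mexp).
have hG t : (\int[m]_x h (x, t) =
    (expR (- t))%:E * \int[m]_(x in [set x | (N x <= t)%R]) f x)%E.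
  rewrite [in RHS]integral_mkcond epatch_indic -ge0_integralZl//=.
  - apply: eq_integral => x _.
    by rewrite /h/= EFinM muleCA indicE.
  - by apply: emeasurable_funM => //; apply/measurable_EFinP/measurable_indic.
  - by move=> x _; apply: mule_ge0 => //; rewrite lee_fin.
transitivity (\int[m]_x \int[lebesgue_measure]_t h (x, t))%E.
  apply: eq_integral => x _; rewrite /h/= ge0_integralZl//=.
  - congr (_ * _)%E; rewrite -integral_expRN integral_mkcond epatch_indic.
    by apply: eq_integral => t _ /=; rewrite EFinM !indicE !mem_setE/= in_itv/= andbT.
  - apply/measurable_EFinP/measurable_funM => //.
    exact: (measurableT_comp (measurable_indic mS) (pair1_measurable x)).
rewrite fubini_tonelli//.
under eq_integral do rewrite hG.
rewrite integral_itv_obnd_cbnd; last first.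
  apply: (measurable_funS measurableT) => //.
  under eq_fun do rewrite -hG.
  exact: measurable_fun_fubini_tonelli_G.
(* Negative t contribute nothing: since N is nonnegative, the sublevel set is then empty. *)
rewrite [in RHS]integral_mkcond.
apply: eq_integral => t _; rewrite patchE; case: ifPn => //.
rewrite mem_setE/= in_itv/= andbT -ltNge => t0.
rewrite (_ : [set x | (N x <= t)%R] = set0) ?integral_set0 ?mule0//.
by apply/seteqP; split=> // x /= /le_lt_trans/(_ t0); rewrite ltNge N0.
Qed.

(** For s < 1 the integrand is unbounded near 0, so the fundamental theorem of calculus is applied
    on the intervals [F k] away from 0, which exhaust ]0, t], and monotone convergence concludes. *)
Lemma integral_powR (R : realType) (s t : R) : 0 < s -> 0 <= t ->
  (\int[lebesgue_measure]_(u in `]0%R, t]) (u `^ (s - 1))%:E = (t `^ s / s)%:E)%E.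
Proof.
move=> s0; rewrite le_eqVlt => /predU1P[<-|t0].
  by rewrite set_itvoc0 integral_set0 powR0 ?mul0r// gt_eqF.
have mf (D : set (measurableTypeR R)) :
    measurable_fun D (fun u : measurableTypeR R => (u `^ (s - 1))%:E).
  apply: (measurable_funS measurableT) => //; apply/measurable_EFinP.
  exact: measurable_powR.
pose F k : set (measurableTypeR R) := `[t / k.+1%:R, t]%classic.
have UF : \bigcup_k F k = `]0, t]%classic.
  apply/seteqP; split => [x [k _]|x]; rewrite /F/= !in_itv/= => /andP[xl xt].
    by rewrite xt andbT (lt_le_trans _ xl)// divr_gt0.
  exists (Num.truncn (t / x)) => //=; rewrite /F/= in_itv/= xt andbT.
  rewrite ler_pdivrMr// mulrC -ler_pdivrMr//.
  by rewrite ltW// truncnS_gt.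
have dF (x : R) : 0 < x -> is_derive x 1 (fun u : R => u `^ s / s) (x `^ (s - 1)).
  move=> x0.
  have /(is_deriveZ s^-1) := is_derive1_powR s x0.
  rewrite (_ : s^-1 \*: _ = (fun u => u `^ s / s)); last first.
    by apply/funext => u; rewrite mulrC.
  by move=> /is_derive_eq; apply; rewrite /GRing.scale/= mulKf// gt_eqF.
(* The index is shifted because [F 0] is the single point t, not a proper interval. *)
have IF k : (\int[lebesgue_measure]_(u in F k.+1) (u `^ (s - 1))%:E =
    ((t `^ s - (t / k.+2%:R) `^ s) / s)%:E)%E.
  have lt : t / k.+2%:R < t by rewrite ltr_pdivrMr// ltr_pMr// ltr1n.
  have pos : 0 < t / k.+2%:R by rewrite divr_gt0.
  have cF (x : R) : 0 < x -> {for x, continuous (fun u : R => u `^ s / s)}.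
    by move=> x0; apply/differentiable_continuous/derivable1_diffP; have [] := dF _ x0.
  rewrite (@continuous_FTC2 _ _ (fun u => u `^ s / s))//.
  - by rewrite -EFinB mulrBl.
  - apply: derivable_within_continuous => x; rewrite in_itv/= => /andP[x0 _].
    by apply: derivable_powR; rewrite in_itv/= andbT (lt_le_trans pos).
  - split.
    + by move=> x; rewrite in_itv/= => /andP[x0 _]; have [] := dF x (lt_trans pos x0).
    + by apply: cvg_at_right_filter; exact: cF.
    + by apply: cvg_at_left_filter; exact: cF.
  - move=> x; rewrite in_itv/= => /andP[x0 _]; rewrite derive1E.
    by have [_ ->] := dF x (lt_trans pos x0).
have c0 : (t / k.+2%:R) `^ s @[k --> \oo] --> 0.
  have /cvg_at_rightP := powR_cvg0 s0; apply; split=> [k|]; first by rewrite divr_gt0.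
  have : t * harmonic k @[k --> \oo] --> t * 0 by apply: cvgMl_tmp; exact: cvg_harmonic.
  by rewrite mulr0 -cvg_shiftS.
have cvgF : (\int[lebesgue_measure]_(u in F k) (u `^ (s - 1))%:E @[k --> \oo] -->
    \int[lebesgue_measure]_(u in \bigcup_k F k) (u `^ (s - 1))%:E)%E.
  apply: ge0_nondecreasing_set_cvg_integral => //.
  - move=> i j ij; apply/subsetPset => x; rewrite /F/= !in_itv/= => /andP[xl ->].
    by rewrite andbT (le_trans _ xl)// ler_pM2l// lef_pV2 ?posrE// ler_nat.
  - by move=> i; exact: measurable_itv.
  - by move=> i x _; rewrite lee_fin powR_ge0.
rewrite -UF -(cvg_lim _ cvgF)//; apply/cvg_lim => //.
rewrite -cvg_shiftS/=; under eq_cvg do rewrite IF.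
apply: cvg_EFin; first exact: nearW.
rewrite -[X in _ --> X / s]subr0.
by apply: cvgMr_tmp; apply: cvgB => //; exact: cvg_cst.
Qed.

(** Extended-real counterpart of [Gamma], which can be manipulated as a nonnegative integral before
    its convergence is known. [GammaE] transfers the results to [Gamma]. *)
Definition eGamma {R : realType} (s : R) : \bar R :=
  (\int[lebesgue_measure]_(t in `]0%R, +oo[) (t `^ (s - 1) * expR (- t))%:E)%E.

Lemma eGamma_ge0 (R : realType) (s : R) : (0 <= eGamma s)%E.
Proof.
by apply: integral_ge0 => t _; rewrite lee_fin mulr_ge0 ?powR_ge0 ?expR_ge0.
Qed.

Lemma measurable_eGamma (R : realType) (s : R) (D : set (measurableTypeR R)) :
  measurable_fun D (fun t : measurableTypeR R => (t `^ (s - 1) * expR (- t))%:E).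
Proof.
apply: (measurable_funS measurableT) => //; apply/measurable_EFinP/measurable_funM.
  exact: measurable_powR.
exact: measurableT_comp.
Qed.

(** The layer-cake identity on the line with N(x) = |x|^q and the power cut off to x > 0. The
    sublevel set at height t becomes ]0, t^(1/q)], over which the power integrates to t^(s/q) /
    s. *)
Lemma integral_powR_expRN (R : realType) (s q : R) : 0 < s -> 0 < q ->
  (\int[lebesgue_measure]_(x in `]0%R, +oo[)
     (x `^ (s - 1) * expR (- (x `^ q)))%:E = s^-1%:E * eGamma (s / q + 1))%E.
Proof.
move=> s0 q0.
have mpow (p : R) : measurable_fun setT (fun x : measurableTypeR R => x `^ p).
  exact: measurable_powR.
have mf : measurable_fun setT
    ((fun x : measurableTypeR R => (x `^ (s - 1))%:E) \_ `]0, +oo[).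
  apply/(measurable_restrictT _ (measurable_itv _)).
  by apply: (measurable_funS measurableT) => //; exact/measurable_EFinP.
have mN : measurable_fun setT (fun x : measurableTypeR R => `|x| `^ q).
  exact: (measurableT_comp (mpow q)).
have := @layer_cake_expRN _ _ _ (@lebesgue_measure R) (fun x => `|x| `^ q)
  ((fun x : R => (x `^ (s - 1))%:E) \_ `]0, +oo[) mN _ mf.
rewrite [X in (_ -> _ -> X = _) -> _](_ : _ =
    \int[lebesgue_measure]_(x in `]0%R, +oo[)
     (x `^ (s - 1) * expR (- (x `^ q)))%:E)%E; last first.
  rewrite [in RHS]integral_mkcond; apply: eq_integral => x _.
  rewrite !patchE; case: ifPn => [|_]; last by rewrite mul0e.
  by rewrite inE/= in_itv/= andbT => x0; rewrite ger0_norm ?ltW.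
move=> ->; last 2 first.
- by move=> x; exact: powR_ge0.
- by move=> x; rewrite patchE; case: ifPn => // _; rewrite lee_fin powR_ge0.
rewrite /eGamma -ge0_integralZl//=; last 3 first.
- exact: measurable_eGamma.
- by move=> x _; rewrite lee_fin mulr_ge0 ?powR_ge0 ?expR_ge0.
- by rewrite lee_fin invr_ge0 ltW.
apply: eq_integral => t; rewrite inE/= in_itv/= andbT => t0.
rewrite -integral_mkcondr (_ : _ `&` _ = `]0, t `^ q^-1]%classic).
  rewrite integral_powR ?powR_ge0// addrK -!EFinM -powRrM (mulrC _ s).
  by congr EFin; ring.
have powK (p x : R) : 0 < p -> 0 < x -> (x `^ p) `^ p^-1 = x.
  by move=> p0 x0; rewrite -powRrM divff ?gt_eqF// powRr1 ?ltW.
apply/seteqP; split=> x /=; rewrite !in_itv/= ?andbT.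
  move=> [xt x0]; rewrite x0/= -(powK q x)// ge0_ler_powR ?nnegrE ?powR_ge0//.
  - by rewrite invr_ge0 ltW.
  - exact: ltW.
  - by rewrite -(ger0_norm (ltW x0)).
move=> /andP[x0 xt]; split=> //; rewrite (ger0_norm (ltW x0)).
rewrite -(powK q^-1 t) ?invr_gt0// invrK.
by rewrite ge0_ler_powR ?nnegrE ?powR_ge0// ltW.
Qed.

(** The case q = 1 of [integral_powR_expRN], whose left-hand side is then [eGamma s] itself. *)
Lemma eGammaD1 (R : realType) (s : R) : 0 < s ->
  eGamma (s + 1) = (s%:E * eGamma s)%E.
Proof.
move=> s0; have := integral_powR_expRN s0 ltr01; rewrite divr1.
rewrite (_ : integral _ _ _ = eGamma s).
  by move=> ->; rewrite muleA -EFinM divff ?gt_eqF// mul1e.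
apply: eq_integral => x; rewrite inE/= in_itv/= andbT => x0.
by rewrite powRr1 ?ltW.
Qed.

Lemma eGamma1 (R : realType) : eGamma (1 : R) = 1%E.
Proof.
transitivity (\int[@lebesgue_measure R]_(t in `]0%R, +oo[) (expR (- t))%:E)%E.
  by apply: eq_integral => t _; rewrite subrr powRr0 mul1r.
rewrite integral_itv_obnd_cbnd ?integral_expRN ?oppr0 ?expR0//.
apply: (measurable_funS measurableT) => //; apply/measurable_EFinP.
exact: measurableT_comp.
Qed.

Lemma eGamma_nat_lty (R : realType) (n : nat) : (eGamma (n.+1%:R : R) < +oo)%E.
Proof.
elim: n => [|n IH]; first by rewrite eGamma1 ltry.
by rewrite -natr1 eGammaD1// lte_mul_pinfty.
Qed.

(** Every later estimate of Gamma reduces to such a pointwise comparison of powers: finiteness,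
    positivity, and the two bounds near 1. *)
Lemma eGamma_le (R : realType) (x y z a b : R) : 0 <= a -> 0 <= b ->
  (forall t, 0 < t ->
     t `^ (x - 1) <= a * t `^ (y - 1) + b * t `^ (z - 1)) ->
  (eGamma x <= a%:E * eGamma y + b%:E * eGamma z)%E.
Proof.
move=> a0 b0 H; rewrite /eGamma.
have i0 (s t : R) : (0 <= (t `^ (s - 1) * expR (- t))%:E)%E.
  by rewrite lee_fin mulr_ge0 ?powR_ge0 ?expR_ge0.
have mk k s : measurable_fun (`]0, +oo[%classic : set (measurableTypeR R))
    (fun t => (k%:E * (t `^ (s - 1) * expR (- t))%:E)%E).
  by apply: measurable_funeM; exact: measurable_eGamma.
rewrite -!ge0_integralZl//=; try exact: measurable_eGamma.
rewrite -ge0_integralD//=; try by move=> t _; rewrite mule_ge0.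
apply: ge0_le_integral => //=; first exact: measurable_eGamma.
- by apply: emeasurable_funD; exact: mk.
move=> t; rewrite in_itv/= andbT => t0.
rewrite -!EFinM -EFinD lee_fin !mulrA -mulrDl ler_wpM2r ?expR_ge0//.
exact: H.
Qed.

(** The power with the smaller exponent dominates on ]0, 1], the one with the larger exponent beyond
    1. *)
Lemma eGamma_le_add (R : realType) (x y z : R) : y <= x <= z ->
  (eGamma x <= eGamma y + eGamma z)%E.
Proof.
move=> /andP[yx xz]; rewrite -(mul1e (eGamma y)) -(mul1e (eGamma z)).
apply: eGamma_le => // t t0; rewrite !mul1r.
have [t1|/ltW t1] := leP t 1.
  by rewrite -[leLHS]addr0 lerD ?powR_ge0// ger_powR ?t0// lerD2r.
by rewrite -[leLHS]add0r lerD ?powR_ge0// ler_powR// lerD2r.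
Qed.

(** The functional equation moves the question from s to s + 1, which lies between the positive
    integers 1 and [(Num.truncn s).+2], where finiteness follows by induction. *)
Lemma eGamma_lty (R : realType) (s : R) : 0 < s -> (eGamma s < +oo)%E.
Proof.
move=> s0; suff : (eGamma (s + 1) < +oo)%E.
  rewrite eGammaD1//; have := eGamma_ge0 s.
  by case: (eGamma s) => [r|_|//]; rewrite ?ltry// gt0_muley.
apply: (@le_lt_trans _ _ (eGamma 1 + eGamma (Num.truncn s).+2%:R)%E); last first.
  by rewrite lte_add_pinfty// ?eGamma1 ?ltry// eGamma_nat_lty.
apply: eGamma_le_add; rewrite lerDr ltW//= -[leRHS]natr1 lerD2r ltW//.
exact: truncnS_gt.
Qed.

Lemma GammaE (R : realType) (s : R) : 0 < s -> (Gamma s)%:E = eGamma s.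
Proof.
by move=> s0; rewrite fineK// ge0_fin_numE ?eGamma_ge0 ?eGamma_lty.
Qed.

Lemma Gamma_le (R : realType) (x y z a b : R) :
  0 < x -> 0 < y -> 0 < z -> 0 <= a -> 0 <= b ->
  (forall t, 0 < t ->
     t `^ (x - 1) <= a * t `^ (y - 1) + b * t `^ (z - 1)) ->
  Gamma x <= a * Gamma y + b * Gamma z.
Proof.
move=> x0 y0 z0 a0 b0 H; have := eGamma_le a0 b0 H.
by case: _ / (GammaE x0); case: _ / (GammaE y0); case: _ / (GammaE z0).
Qed.

Lemma GammaD1 (R : realType) (s : R) : 0 < s -> Gamma (s + 1) = s * Gamma s.
Proof.
move=> s0; have s10 : 0 < s + 1 by rewrite addr_gt0.
have := eGammaD1 s0; case: _ / (GammaE s10); case: _ / (GammaE s0).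
exact: EFin_inj.
Qed.

Lemma Gamma1 (R : realType) : Gamma (1 : R) = 1.
Proof. by apply: EFin_inj; rewrite GammaE// eGamma1. Qed.

Lemma Gamma_nat_gt0 (R : realType) (n : nat) : 0 < Gamma (n.+1%:R : R).
Proof.
elim: n => [|n IH]; first by rewrite Gamma1.
by rewrite -natr1 GammaD1// mulr_gt0.
Qed.

(** A positive integer m lies between s and s + 1, so 0 < Gamma(m) <= Gamma(s) + Gamma(s + 1) = (1 +
    s) Gamma(s). *)
Lemma Gamma_gt0 (R : realType) (s : R) : 0 < s -> 0 < Gamma s.
Proof.
move=> s0; have s1 : 0 < s + 1 by rewrite addr_gt0.
suff : 0 < (1 + s) * Gamma s by rewrite pmulr_rgt0// addrC.
apply: (lt_le_trans (Gamma_nat_gt0 R (Num.truncn s))).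
rewrite mulrDl mul1r -(GammaD1 s0).
have /eGamma_le_add : s <= (Num.truncn s).+1%:R <= s + 1.
  by rewrite ltW ?truncnS_gt//= -natr1 lerD2r truncn_le ltW.
case: _ / (GammaE s0); case: _ / (GammaE s1).
by case: _ / (GammaE (ltr0Sn _ _)).
Qed.

(** * Behaviour of Gamma(1 + s) as s tends to 0 from the right *)

Lemma powR_le_affine (R : realType) (s t : R) : 0 <= s <= 1 -> 0 < t ->
  t `^ s <= 1 - s + s * t.
Proof.
move=> /andP[s0 s1] t0; set u := 1 - s + s * t.
have u0 : 0 < u.
  have [s00|sN0] := eqVneq s 0; first by rewrite /u s00; lra.
  by rewrite /u ltr_wpDl ?subr_ge0// mulr_gt0// lt0r sN0.
rewrite -[leRHS]lnK// /powR gt_eqF// ler_expR.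
(* Tangent bound for [ln] at u. Since u is the mean of 1 and t with weights 1 - s and s, averaging
   the bound over these two points gives s ln t <= ln u. *)
have H x : 0 < x -> ln x - ln u <= x / u - 1.
  move=> x0; rewrite -ln_div// lerBrDl.
  by rewrite -[leRHS](@lnK _ (x / u)) ?posrE ?divr_gt0// expR_ge1Dx.
have H1 := H 1 ltr01; have Ht := H t t0; rewrite ln1 in H1.
have A : s * (ln t - ln u) <= s * (t / u - 1) by rewrite ler_wpM2l.
have B : (1 - s) * (0 - ln u) <= (1 - s) * (1 / u - 1).
  by rewrite ler_wpM2l ?subr_ge0.
have C : s * (t / u) + (1 - s) * (1 / u) = 1.
  by rewrite !mulrA -mulrDl mulr1 addrC divff ?gt_eqF.
nra.
Qed.

(* From [ln t >= - 2 * t `^ (- 2^-1)]; this lower bound, unlike [1 - t^-1], is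
   integrable against [expR (- t)] near 0. *)
Lemma powR_ge_1B (R : realType) (s t : R) : 0 <= s -> 0 < t ->
  1 <= t `^ s + 2 * s * t `^ (- 2^-1).
Proof.
move=> s0 t0; set y := t `^ (- 2^-1).
have y0 : 0 < y by exact: powR_gt0.
have lny : ln y = - 2^-1 * ln t by rewrite ln_powR.
have A : 1 + s * ln t <= t `^ s by rewrite /powR gt_eqF// expR_ge1Dx.
have B := ln_sublinear y0.
nra.
Qed.

(** Integrating [powR_le_affine] against exp(-t) gives the bound (1 - s) Gamma(1) + s Gamma(2) =
    1. *)
Lemma Gamma1D_le (R : realType) (s : R) : 0 <= s <= 1 -> Gamma (1 + s) <= 1.
Proof.
move=> s01; have /andP[s0 s1] := s01.
apply: (@le_trans _ _ ((1 - s) * Gamma 1 + s * Gamma (1 + 1))).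
  apply: Gamma_le; rewrite ?subr_ge0//; first exact: ltr_pwDl.
  move=> t t0.
  by rewrite [1 + s]addrC !addrK subrr powRr0 mulr1 (powRr1 (ltW t0)) powR_le_affine.
by rewrite GammaD1// Gamma1; lra.
Qed.

(** Integration of [powR_ge_1B] against exp(-t); the power t^(-1/2) integrates to Gamma(1/2). *)
Lemma Gamma1D_ge (R : realType) (s : R) : 0 <= s ->
  1 - 2 * s * Gamma (2^-1) <= Gamma (1 + s).
Proof.
move=> s0; rewrite lerBlDr -[leLHS]Gamma1 -[X in _ <= X + _]mul1r.
apply: Gamma_le; rewrite ?invr_gt0//; [exact: ltr_pwDl|exact: mulr_ge0|].
move=> t t0.
rewrite [1 + s]addrC addrK subrr powRr0 mul1r.
by rewrite (_ : 2^-1 - 1 = - 2^-1) ?powR_ge_1B//; lra.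
Qed.

Lemma cvg_Gamma1D_div (R : realType) (a : R) : 0 <= a ->
  Gamma (1 + a / q) @[q --> +oo] --> (1 : R).
Proof.
move=> a0.
have aq0 : a / q @[q --> +oo] --> (0 : R).
  rewrite -[X in _ --> X](mulr0 a); apply: cvgMl_tmp.
  apply/(gtr0_cvgV0 (f := id)); last exact: cvg_id.
  exact: nbhs_pinfty_gt.
apply: (@squeeze_cvgr _ _ _ _ (fun q => 1 - 2 * (a / q) * Gamma 2^-1) (cst 1)).
- near=> q.
  have q0 : 0 <= a / q.
    by rewrite divr_ge0//; near: q; exact: nbhs_pinfty_ge.
  rewrite Gamma1D_ge//= Gamma1D_le// q0/=.
  rewrite ler_pdivrMr; last by near: q; exact: nbhs_pinfty_gt.
  by rewrite mul1r; near: q; apply: nbhs_pinfty_ge; exact: num_real.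
- rewrite -[X in _ --> X]subr0; apply: cvgB; first exact: cvg_cst.
  rewrite -(mul0r (Gamma 2^-1)) -(mulr0 2).
  by apply: cvgMr_tmp; apply: cvgMl_tmp.
- exact: cvg_cst.
Unshelve. all: by end_near. Qed.

(** * Product Lebesgue measure: factorization and diagonal scaling *)

(** By uniqueness of Lebesgue measure: |s| times its pushforward under x -> s x agrees with it on
    the intervals ]a, b]. Negative s is included for the sake of the reflections used later. *)
Lemma ge0_integral_comp_scale (R : realType) (s : R)
    (f : measurableTypeR R -> \bar R) :
  s != 0 -> measurable_fun setT f -> (forall x, 0 <= f x)%E ->
  (\int[lebesgue_measure]_x f (s * x)%R =
   `|s|^-1%:E * \int[lebesgue_measure]_x f x)%E.
Proof.
move=> s0 mf f0.
have ms : measurable_fun setT (fun x : measurableTypeR R => s * x : measurableTypeR R).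
  exact: mulrl_measurable.
pose k : {nonneg R} := NngNum (normr_ge0 s).
pose m : {measure set (measurableTypeR R) -> \bar R} :=
  measure_function_pushforward__canonical__measure_function_Measure
    (@lebesgue_measure R) ms.
have mE (A : set (measurableTypeR R)) :
    measurable A -> @lebesgue_measure R A = mscale k m A.
  apply: lebesgue_measure_unique => _ [[a b]] _ <-.
  have pre : (fun x => s * x) @^-1` `]a, b] =
      (if 0 < s then `]a / s, b / s] else `[b / s, a / s[)%classic.
    case: ifPn => sp; apply/seteqP; split=> x /=; rewrite !in_itv/=.
    - by rewrite ltr_pdivrMr// ler_pdivlMr// ![x * s]mulrC.
    - by rewrite ltr_pdivrMr// ler_pdivlMr// ![x * s]mulrC.
    - have sn : s < 0 by rewrite lt_neqAle s0 leNgt.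
      by rewrite ler_ndivrMr// ltr_ndivlMr// ![x * s]mulrC andbC.
    - have sn : s < 0 by rewrite lt_neqAle s0 leNgt.
      by rewrite ler_ndivrMr// ltr_ndivlMr// ![x * s]mulrC andbC.
  transitivity (`|s|%:E * @lebesgue_measure R ((fun x => (s * x)%R) @^-1` `]a, b]))%E; last by [].
  rewrite pre; have [sp|sp] := boolP (0 < s).
    rewrite !lebesgue_measure_itv/= !lte_fin ltr_pM2r ?invr_gt0//.
    case: ifPn => _; last by rewrite mule0.
    by rewrite -!EFinB -EFinM gtr0_norm// -mulrBl mulrC divfK.
  have sn : s < 0 by rewrite lt_neqAle s0 leNgt.
  rewrite !lebesgue_measure_itv/= !lte_fin ltr_nM2r ?invr_lt0//.
  case: ifPn => _; last by rewrite mule0.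
  by rewrite -!EFinB -EFinM ltr0_norm// -mulrBl mulrC mulrN divfK// opprB.
have key : (\int[lebesgue_measure]_x f x =
    `|s|%:E * \int[lebesgue_measure]_x f (s * x)%R)%E.
  transitivity (\int[mscale k m]_x f x)%E.
    by apply: eq_measure_integral => A mA _; exact: mE.
  rewrite ge0_integral_mscale//; congr (_ * _)%E.
  by rewrite (ge0_integral_pushforward ms)//= preimage_setT.
by rewrite key muleA -EFinM mulVf ?normr_eq0// mul1e.
Qed.

Lemma ge0_integral_tupleS (R : realType) (n : nat)
    (f : n.+1.-tuple (measurableTypeR R) -> \bar R) :
  measurable_fun setT f -> (forall t, 0 <= f t)%E ->
  (\int[lebesgue_tuple n.+1]_t f t =
   \int[lebesgue_measure]_x \int[lebesgue_tuple n]_t f (tuple_cons (x, t)))%E.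
Proof.
move=> mf f0.
rewrite [LHS](ge0_integral_pushforward (@measurable_tuple_cons R n))//=.
rewrite preimage_setT fubini_tonelli1//=.
apply: measurableT_comp => //; exact: measurable_tuple_cons.
Qed.

Lemma ge0_integral_tuple0 (R : realType)
    (f : 0.-tuple (measurableTypeR R) -> \bar R) :
  measurable_fun setT f -> (\int[lebesgue_tuple 0]_t f t = f [tuple])%E.
Proof. by move=> mf; rewrite /= integral_dirac// diracE in_setT mul1e. Qed.

Definition tuple_scale (R : realType) (n : nat) (s : 'I_n -> R)
    (t : n.-tuple (measurableTypeR R)) : n.-tuple (measurableTypeR R) :=
  [tuple s i * tnth t i | i < n].

Lemma measurable_tuple_scale (R : realType) (n : nat) (s : 'I_n -> R) :
  measurable_fun setT (tuple_scale s).
Proof.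
apply/measurable_fun_tnthP => i.
rewrite (_ : _ \o _ = fun t => s i * tnth t i); last first.
  by apply/funext => t /=; rewrite tnth_mktuple.
apply: (measurableT_comp (mulrl_measurable (s i))).
exact: measurable_tnth.
Qed.

(** Induction on the dimension, peeling off one coordinate by Tonelli. Separate factors per
    coordinate cover both dilations (all factors equal) and sign flips (factors 1 and -1). *)
Lemma ge0_integral_tuple_scale (R : realType) (n : nat) (s : 'I_n -> R)
    (f : n.-tuple (measurableTypeR R) -> \bar R) :
  (forall i, s i != 0) -> measurable_fun setT f -> (forall t, 0 <= f t)%E ->
  (\int[lebesgue_tuple n]_t f (tuple_scale s t) =
   (\prod_i `|s i|^-1)%:E * \int[lebesgue_tuple n]_t f t)%E.
Proof.
elim: n s f => [|n IH] s f s0 mf f0.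
  rewrite !ge0_integral_tuple0//; last first.
    exact: (measurableT_comp mf (measurable_tuple_scale s)).
  by rewrite big_ord0 mul1e [tuple_scale _ _]tuple0.
have mcons (x : R) : measurable_fun setT
    (fun t : n.-tuple (measurableTypeR R) => f (tuple_cons (x, t))).
  apply: measurableT_comp => //.
  by apply: (measurableT_comp (@measurable_tuple_cons R n)); exact: pair1_measurable.
rewrite !ge0_integral_tupleS//; last first.
  exact: (measurableT_comp mf (measurable_tuple_scale s)).
pose s' i := s (lift ord0 i).
have scaleS x t : tuple_scale s (tuple_cons (x, t)) =
    tuple_cons (s ord0 * x, tuple_scale s' t).
  apply: eq_from_tnth => i; rewrite tnth_mktuple.
  case: (unliftP ord0 i) => [j ->|->]; first by rewrite !tnthS tnth_mktuple.
  by rewrite !tnth0.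
pose G (x : measurableTypeR R) : \bar R := (\int[lebesgue_tuple n]_t f (tuple_cons (x, t)))%E.
have G0 x : (0 <= G x)%E by exact: integral_ge0.
have mG : measurable_fun setT G.
  apply: (@measurable_fun_fubini_tonelli_F _ _ _ _ _ _ (f \o @tuple_cons R n)).
    exact: (measurableT_comp mf (@measurable_tuple_cons R n)).
  by move=> x; exact: f0.
have ms : measurable_fun setT
    (fun x : measurableTypeR R => s ord0 * x : measurableTypeR R).
  exact: mulrl_measurable.
transitivity (\int[lebesgue_measure]_x
    ((\prod_i `|s' i|^-1)%:E * G (s ord0 * x)%R))%E.
  apply: eq_integral => x _; under eq_integral do rewrite scaleS.
  by rewrite (IH s' (fun t => f (tuple_cons (s ord0 * x, t))))// => i; exact: s0.
rewrite big_ord_recl mulrC EFinM -muleA -(ge0_integral_comp_scale (s0 ord0) mG G0).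
rewrite -/s'; clearbody G; apply: ge0_integralZl => //.
- exact: (measurableT_comp mG ms).
- by rewrite lee_fin prodr_ge0// => i _; rewrite invr_ge0.
Qed.

(** The one-dimensional integrals are supplied as real numbers [c i], so that their finiteness is
    part of the data and the product is taken in R. *)
Lemma ge0_integral_tuple_prod (R : realType) (n : nat)
    (f : 'I_n -> R -> R) (c : 'I_n -> R) :
  (forall i, measurable_fun setT (f i : measurableTypeR R -> R)) ->
  (forall i x, 0 <= f i x) ->
  (forall i, \int[lebesgue_measure]_x (f i x)%:E = (c i)%:E)%E ->
  (\int[lebesgue_tuple n]_t (\prod_i f i (tnth t i))%:E = (\prod_i c i)%:E)%E.
Proof.
elim: n f c => [|n IH] f c mf f0 fc.
  rewrite ge0_integral_tuple0 ?big_ord0//.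
  by under eq_fun do rewrite big_ord0; exact: measurable_cst.
have mprod m (g : 'I_m -> R -> R) :
    (forall i, measurable_fun setT (g i : measurableTypeR R -> R)) ->
    measurable_fun setT
      (fun t : m.-tuple (measurableTypeR R) => (\prod_i g i (tnth t i))%:E).
  move=> mg; apply/measurable_EFinP/measurable_prod => i _.
  by apply: (measurableT_comp (mg i)); exact: measurable_tnth.
rewrite ge0_integral_tupleS//; last 2 first.
- exact: mprod.
- by move=> t; rewrite lee_fin prodr_ge0.
pose f' i := f (lift ord0 i).
have consE x (t : n.-tuple (measurableTypeR R)) :
    (\prod_i f i (tnth (tuple_cons (x, t)) i))%:E =
    ((f ord0 x)%:E * (\prod_i f' i (tnth t i))%:E)%E.
  rewrite -EFinM big_ord_recl tnth0; congr (_ * _)%:E.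
  by apply: eq_bigr => i _; rewrite tnthS.
transitivity (\int[lebesgue_measure]_x
    ((f ord0 x)%:E * (\prod_i c (lift ord0 i))%:E))%E.
  apply: eq_integral => x _.
  rewrite -(IH f' _ (fun i => mf _) (fun i => f0 _) (fun i => fc _)).
  under eq_integral do rewrite consE.
  rewrite ge0_integralZl//=.
  - by apply: mprod => i; exact: mf.
  - by move=> t _; rewrite lee_fin prodr_ge0// => i _; exact: f0.
  - by rewrite lee_fin.
have c0 i : 0 <= c i.
  by rewrite -lee_fin -fc; apply: integral_ge0 => y _; rewrite lee_fin.
rewrite ge0_integralZr//=; last 3 first.
- exact/measurable_EFinP.
- by move=> x _; rewrite lee_fin.
- by rewrite lee_fin prodr_ge0.
by rewrite fc -EFinM big_ord_recl.
Qed.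

Lemma ge0_integral_cV (R : realType) (n : nat) (f : 'cV[R]_n -> \bar R) :
  measurable_fun setT f -> (forall x, 0 <= f x)%E ->
  (\int[lebesgue_cV]_x f x = \int[lebesgue_tuple n]_t f (cV_of_tuple t))%E.
Proof.
move=> mf f0.
by rewrite (ge0_integral_pushforward (@measurable_cV_of_tuple R n))//= preimage_setT.
Qed.

Lemma measurable_cV_coord (R : realType) (n : nat) (i : 'I_n) :
  measurable_fun setT (fun x : 'cV[R]_n => x i ord0).
Proof.
rewrite (_ : (fun _ => _) = (fun t => tnth t i) \o @tuple_of_cV R n); last first.
  by apply/funext => x /=; rewrite tnth_mktuple.
apply: (measurableT_comp (measurable_tnth i)).
exact: measurable_tuple_of_cV.
Qed.

Definition cV_scale (R : realType) (n : nat) (s : 'I_n -> R) (x : 'cV[R]_n) :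
  'cV[R]_n := \col_i (s i * x i ord0).

Lemma cV_scale_tuple (R : realType) (n : nat) (s : 'I_n -> R)
    (t : n.-tuple (measurableTypeR R)) :
  cV_scale s (cV_of_tuple t) = cV_of_tuple (tuple_scale s t).
Proof. by apply/colP => i; rewrite !mxE tnth_mktuple. Qed.

Lemma measurable_cV_scale (R : realType) (n : nat) (s : 'I_n -> R) :
  measurable_fun setT (cV_scale s).
Proof.
rewrite (_ : cV_scale s =
    @cV_of_tuple R n \o (tuple_scale s \o @tuple_of_cV R n)); last first.
  by apply/funext => x /=; rewrite -cV_scale_tuple tuple_of_cVK.
apply: (measurableT_comp (@measurable_cV_of_tuple R n)).
apply: (measurableT_comp (measurable_tuple_scale s)).
exact: measurable_tuple_of_cV.
Qed.

Lemma ge0_integral_cV_scale (R : realType) (n : nat) (s : 'I_n -> R)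
    (f : 'cV[R]_n -> \bar R) :
  (forall i, s i != 0) -> measurable_fun setT f -> (forall x, 0 <= f x)%E ->
  (\int[lebesgue_cV]_x f (cV_scale s x) =
   (\prod_i `|s i|^-1)%:E * \int[lebesgue_cV]_x f x)%E.
Proof.
move=> s0 mf f0; rewrite !ge0_integral_cV//; last first.
  exact: (measurableT_comp mf (measurable_cV_scale s)).
under eq_integral do rewrite cV_scale_tuple.
apply: (ge0_integral_tuple_scale (f := f \o @cV_of_tuple R n)) => //.
- exact: (measurableT_comp mf (@measurable_cV_of_tuple R n)).
- by move=> t; exact: f0.
Qed.

Lemma integral_cV_prod (R : realType) (n : nat)
    (f : 'I_n -> R -> R) (c : 'I_n -> R) :
  (forall i, measurable_fun setT (f i : measurableTypeR R -> R)) ->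
  (forall i x, 0 <= f i x) ->
  (forall i, \int[lebesgue_measure]_x (f i x)%:E = (c i)%:E)%E ->
  (\int[@lebesgue_cV R n]_x (\prod_i f i (x i ord0))%:E =
   (\prod_i c i)%:E)%E.
Proof.
move=> mf f0 fc; rewrite ge0_integral_cV.
- rewrite -(ge0_integral_tuple_prod mf f0 fc).
  apply: eq_integral => t _; congr EFin.
  by apply: eq_bigr => i _; rewrite mxE.
- apply/measurable_EFinP/measurable_prod => i _.
  by apply: (measurableT_comp (mf i)); exact: measurable_cV_coord.
- by move=> x; rewrite lee_fin prodr_ge0.
Qed.

(** * Geometry of the l_p balls: sublevel sets, dilations and reflections *)

Lemma lp_ball_EFinE (R : realType) (n : nat) (q r : R) : 0 < q -> 0 <= r ->
  @lp_ball R n q%:E r = [set x | \sum_i `|x i ord0| `^ q <= r `^ q].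
Proof.
move=> q0 r0; have q'0 : 0 <= q^-1 by rewrite invr_ge0 ltW.
have S0 (x : 'cV[R]_n) : 0 <= \sum_i `|x i ord0| `^ q.
  by apply: sumr_ge0 => i _; exact: powR_ge0.
have powK (x s : R) : s != 0 -> 0 <= x -> (x `^ s) `^ s^-1 = x.
  by move=> sN0 x0; rewrite -powRrM divff// powRr1.
have qN0 : q != 0 by rewrite gt_eqF.
apply/seteqP; split=> x; rewrite /lp_ball/=.
  move=> H; rewrite -[leLHS](@powK _ q^-1) ?invr_eq0// invrK.
  by rewrite ge0_ler_powR ?nnegrE ?powR_ge0// ltW.
by move=> H; rewrite -[leRHS](@powK _ q)// ge0_ler_powR ?nnegrE ?powR_ge0.
Qed.

Lemma lp_ball_pinftyE (R : realType) (n : nat) (r : R) : 0 <= r ->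
  @lp_ball R n +oo%E r = [set x | forall i, `|x i ord0| <= r].
Proof.
move=> r0; apply/seteqP; split=> x; rewrite /lp_ball/=.
  by move=> H i; apply: le_trans H; exact: le_bigmax.
by move=> H; apply/bigmax_leP.
Qed.

Lemma measurable_sum_powR (R : realType) (n : nat) (q : R) :
  measurable_fun setT (fun x : 'cV[R]_n => \sum_i `|x i ord0| `^ q).
Proof.
apply: measurable_sum => i.
apply: (measurableT_comp (measurable_powR q)).
apply: (measurableT_comp (@normr_measurable R setT)).
exact: measurable_cV_coord.
Qed.

Lemma measurable_lp_ball (R : realType) (n : nat) (p : \bar R) (r : R) :
  (1 <= p)%E -> 0 <= r -> measurable (@lp_ball R n p r).
Proof.
case: p => [q||//] p1 r0.
  have q0 : 0 < q by rewrite (lt_le_trans ltr01)// -lee_fin.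
  rewrite lp_ball_EFinE// -[X in measurable X]setTI.
  apply: (@measurable_fun_ler _ _ _ setT _ (cst (r `^ q))) => //.
  exact: measurable_sum_powR.
have -> : @lp_ball R n +oo%E r =
    \bigcap_(i in [set: 'I_n]) [set x : 'cV[R]_n | `|x i ord0| <= r].
  rewrite lp_ball_pinftyE//.
  by apply/seteqP; split=> x H i; [move=> _|]; exact: H.
apply: fin_bigcap_measurable => // i _.
rewrite -[X in measurable X]setTI.
apply: (@measurable_fun_ler _ _ _ setT (fun x : 'cV[R]_n => `|x i ord0|) (cst r)) => //.
apply: (measurableT_comp (@normr_measurable R setT)).
exact: measurable_cV_coord.
Qed.

(** Coordinates are bounded on the ball; hence so are polynomials, which makes them integrable
    there. *)
Lemma lp_ball_coord_le (R : realType) (n : nat) (p : \bar R) (r : R) (x : 'cV[R]_n)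
    (i : 'I_n) :
  (1 <= p)%E -> 0 <= r -> lp_ball p r x -> `|x i ord0| <= r.
Proof.
case: p => [q||//] p1 r0; last by rewrite lp_ball_pinftyE//; exact.
have q0 : 0 < q by rewrite (lt_le_trans ltr01)// -lee_fin.
rewrite lp_ball_EFinE//= => H.
have {}H : `|x i ord0| `^ q <= r `^ q.
  apply: le_trans H; rewrite (bigD1 i)//= lerDl.
  by apply: sumr_ge0 => j _; exact: powR_ge0.
rewrite leNgt; apply/negP => /(gt0_ltr_powR q0).
by rewrite !nnegrE ltNge H => /(_ r0 (normr_ge0 _)).
Qed.

Lemma lp_ball_scale (R : realType) (n : nat) (p : \bar R) (r : R) (x : 'cV[R]_n) :
  (1 <= p)%E -> 0 < r ->
  lp_ball p r (cV_scale (fun=> r) x) <-> lp_ball p 1 x.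
Proof.
case: p => [q||//] p1 r0.
  have q0 : 0 < q by rewrite (lt_le_trans ltr01)// -lee_fin.
  rewrite (@lp_ball_EFinE _ n _ _ q0 (ltW r0)) (@lp_ball_EFinE _ n _ _ q0 ler01).
  rewrite /= powR1.
  under eq_bigr do rewrite mxE normrM (ger0_norm (ltW r0)) powRM ?(ltW r0)//.
  by rewrite -mulr_sumr ger_pMr ?powR_gt0.
rewrite (@lp_ball_pinftyE _ n _ (ltW r0)) (@lp_ball_pinftyE _ n _ ler01)/=.
split=> H i; have := H i; rewrite !mxE.
  by rewrite normrM (ger0_norm (ltW r0)) ger_pMr.
by rewrite normrM (ger0_norm (ltW r0)) ger_pMr.
Qed.

Lemma lp_norm_sign (R : realType) (n : nat) (p : \bar R) (s : 'I_n -> R)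
    (x : 'cV[R]_n) :
  (forall i, `|s i| = 1) -> lp_norm p (cV_scale s x) = lp_norm p x.
Proof.
move=> s1; have E i : `|cV_scale s x i ord0| = `|x i ord0|.
  by rewrite mxE normrM s1 mul1r.
case: p => [q||//] /=; first by under eq_bigr do rewrite E.
by apply: eq_bigr => i _; rewrite E.
Qed.

(** * Moments of the unit ball *)

Lemma ge0_integral_even (R : realType) (f : measurableTypeR R -> \bar R) :
  measurable_fun setT f -> (forall x, 0 <= f x)%E -> (forall x, f (- x) = f x) ->
  (\int[lebesgue_measure]_x f x =
   2%:E * \int[lebesgue_measure]_(x in `]0%R, +oo[) f x)%E.
Proof.
move=> mf f0 fN.
have mfS (D : set (measurableTypeR R)) : measurable_fun D f.
  exact: (measurable_funS measurableT).
rewrite -(set_itvNyy R) (@itv_bndbnd_setU _ _ _ (BRight (0 : R)))//.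
rewrite ge0_integral_setU//=; last first.
  apply/disj_setPRL => x /=; rewrite !in_itv/= andbT => x0.
  by apply/negP; rewrite -ltNge.
have -> : (\int[lebesgue_measure]_(x in `]-oo, 0%R]) f x =
    \int[lebesgue_measure]_(x in `]0%R, +oo[) f x)%E.
  rewrite integral_itv_obnd_cbnd; last exact: mfS.
  rewrite (ge0_integration_by_substitution0 mf f0).
  by apply: eq_integral => x _; rewrite fN.
by rewrite mule_natl mule2n.
Qed.

Lemma measurable_normX_expRN (R : realType) (a : nat) (q : R) :
  measurable_fun setT
    (fun x : measurableTypeR R => `|x| ^+ a * expR (- (`|x| `^ q))).
Proof.
apply: measurable_funM; first by apply: measurable_funX; exact: normr_measurable.
apply: (measurableT_comp (@measurable_expR R)).
apply: (measurableT_comp (@oppr_measurable R setT)).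
exact: (measurableT_comp (measurable_powR q)).
Qed.

(** By evenness, twice the half-line integral [integral_powR_expRN] at s = a + 1. *)
Lemma integral_normX_expRN (R : realType) (a : nat) (q : R) : 0 < q ->
  (\int[lebesgue_measure]_x (`|x| ^+ a * expR (- (`|x| `^ q)))%:E =
   (2 / a.+1%:R * Gamma (1 + a.+1%:R / q))%:E)%E.
Proof.
move=> q0; rewrite ge0_integral_even; last 3 first.
- by apply/measurable_EFinP; exact: measurable_normX_expRN.
- by move=> x; rewrite lee_fin mulr_ge0 ?exprn_ge0 ?expR_ge0.
- by move=> x; rewrite normrN.
have -> : (\int[lebesgue_measure]_(x in `]0%R, +oo[)
      (`|x| ^+ a * expR (- `|x| `^ q))%:E =
    \int[lebesgue_measure]_(x in `]0%R, +oo[)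
      (x `^ (a.+1%:R - 1) * expR (- x `^ q))%:E)%E.
  apply: eq_integral => x; rewrite inE/= in_itv/= andbT => x0.
  by rewrite ger0_norm ?ltW// -natr1 addrK powR_mulrn// ltW.
rewrite (integral_powR_expRN (ltr0Sn R a) q0) -GammaE; last first.
  by rewrite ltr_pwDr// divr_ge0// ltW.
by rewrite -!EFinM mulrA [1 + _]addrC.
Qed.

Lemma measurable_normX_le1 (R : realType) (a : nat) :
  measurable_fun setT
    ((fun x : R => `|x| ^+ a * (`|x| <= 1)%R%:R) : measurableTypeR R -> R).
Proof.
pose S : set (measurableTypeR R) := [set y | `|y| <= 1].
have mS : measurable S.
  rewrite -[X in measurable X]setTI.
  apply: (@measurable_fun_ler _ _ _ setT (fun x : measurableTypeR R => `|x|)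
    (cst 1)) => //.
  exact: normr_measurable.
apply: measurable_funM; first by apply: measurable_funX; exact: normr_measurable.
rewrite (_ : (fun _ => _) = \1_S); first exact: measurable_indic.
apply/funext => x; rewrite indicE; congr ((nat_of_bool _)%:R).
by apply/idP/idP; rewrite inE.
Qed.

(** Counterpart for the cube: the indicator of [-1, 1] replaces exp(-|x|^q), and the value is the
    previous one with the Gamma factor set to 1. *)
Lemma integral_normX_le1 (R : realType) (a : nat) :
  (\int[lebesgue_measure]_x (`|x| ^+ a * (`|x| <= 1)%R%:R)%:E =
   (2 / a.+1%:R)%:E :> \bar R)%E.
Proof.
rewrite ge0_integral_even; last 3 first.
- by apply/measurable_EFinP; exact: measurable_normX_le1.
- by move=> x; rewrite lee_fin mulr_ge0 ?exprn_ge0.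
- by move=> x; rewrite normrN.
transitivity (2%:E * \int[lebesgue_measure]_(x in `]0%R, 1%R])
    ((x : R) `^ (a.+1%:R - 1))%:E)%E; last first.
  by rewrite integral_powR// powR1 -EFinM mul1r.
congr (_ * _)%E; rewrite integral_mkcond [RHS]integral_mkcond.
apply: eq_integral => x _; rewrite !patchE !mem_setE/= !in_itv/= andbT.
case: ifPn => //= x0; rewrite (ger0_norm (ltW x0)).
by case: (x <= 1); rewrite ?mulr1 ?mulr0// -natr1 addrK powR_mulrn// ltW.
Qed.

(** Absolute values keep the integrand nonnegative, as Tonelli and the scaling lemmas require; with
    even exponents this is the ordinary monomial. *)
Definition norm_monomial (R : realType) (n : nat) (a : 'I_n -> nat)
  (x : 'cV[R]_n) : R := \prod_i `|x i ord0| ^+ a i.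

Lemma measurable_norm_monomial (R : realType) (n : nat) (a : 'I_n -> nat) :
  measurable_fun setT (@norm_monomial R n a).
Proof.
apply: measurable_prod => i _; apply: measurable_funX.
apply: (measurableT_comp (@normr_measurable R setT)).
exact: measurable_cV_coord.
Qed.

Lemma norm_monomial_ge0 (R : realType) (n : nat) (a : 'I_n -> nat) (x : 'cV[R]_n) :
  0 <= norm_monomial a x.
Proof. by apply: prodr_ge0 => i _; exact: exprn_ge0. Qed.

(** In the exponent of r, n comes from the Jacobian of the dilation and the sum from the degree of
    the monomial. *)
Lemma integral_lp_ball_norm_monomial_scale (R : realType) (n : nat) (p : \bar R)
    (r : R) (a : 'I_n -> nat) : (1 <= p)%E -> 0 < r ->
  (\int[lebesgue_cV]_(x in lp_ball p r) (norm_monomial a x)%:E =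
   (r ^+ (n + \sum_i a i))%:E *
   \int[lebesgue_cV]_(x in lp_ball p 1) (norm_monomial a x)%:E)%E.
Proof.
move=> p1 r0.
have mres s : 0 < s -> measurable_fun setT
    ((fun x => (norm_monomial a x)%:E) \_ (@lp_ball R n p s)).
  move=> s0; apply/(measurable_restrictT _ (measurable_lp_ball p1 (ltW s0))).
  by apply/measurable_funTS/measurable_EFinP; exact: measurable_norm_monomial.
have res0 s x : (0 <= ((fun x => (norm_monomial a x)%:E) \_ (@lp_ball R n p s)) x)%E.
  by rewrite patchE; case: ifPn => // _; rewrite lee_fin norm_monomial_ge0.
have := @ge0_integral_cV_scale R n (fun=> r) _ (fun=> lt0r_neq0 r0) (mres r r0) (res0 r).
rewrite big_const_ord iter_mulr_1 (gtr0_norm r0) => H.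
have -> : (r ^+ (n + \sum_i a i))%:E = ((r ^+ n)%:E * (r ^+ (\sum_i a i))%:E)%E.
  by rewrite -EFinM exprD.
rewrite -muleA -ge0_integralZl; last 4 first.
- exact: measurable_lp_ball.
- by apply/measurable_funTS/measurable_EFinP; exact: measurable_norm_monomial.
- by move=> x _; rewrite lee_fin norm_monomial_ge0.
- by rewrite lee_fin exprn_ge0// ltW.
transitivity ((r ^+ n)%:E * ((r^-1 ^+ n)%:E *
    \int[lebesgue_cV]_(x in lp_ball p r) (norm_monomial a x)%:E))%E.
  by rewrite muleA -EFinM exprVn divff ?mul1e// expf_neq0// gt_eqF.
congr (_ * _)%E; rewrite [X in (_ * X)%E]integral_mkcond -H.
rewrite [RHS]integral_mkcond; apply: eq_integral => x _; rewrite !patchE.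
have [H1 H2] := lp_ball_scale x p1 r0.
case: ifPn => [/set_mem/H1/mem_set ->|Hx].
  rewrite -EFinM; congr EFin; rewrite /norm_monomial.
  under eq_bigr do rewrite mxE normrM (gtr0_norm r0) exprMn.
  by rewrite big_split/= prodrXr.
by case: ifPn => // /set_mem/H2/mem_set; rewrite (negbTE Hx).
Qed.

Lemma integral_lp_ball1_norm_monomial (R : realType) (n : nat) (p : \bar R)
    (a : 'I_n -> nat) : (1 <= p)%E ->
  (\int[lebesgue_cV]_(x in lp_ball p 1) (norm_monomial a x)%:E =
   (\prod_i (2 / (a i).+1%:R * Gamma (1 + (a i).+1%:R / fine p)) /
    Gamma (1 + (n + \sum_i a i)%:R / fine p))%:E)%E.
Proof.
case: p => [q||//] p1; last first.
  (* At p = +oo both [fine p] and its inverse are 0, so every Gamma factor is Gamma(1) = 1 and what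
     remains is a moment of the cube. *)
  rewrite invr0; under eq_bigr do rewrite mulr0 addr0 Gamma1 mulr1.
  rewrite mulr0 addr0 Gamma1 divr1.
  rewrite -(@integral_cV_prod R n
    (fun i y => `|y| ^+ a i * (`|y| <= 1)%R%:R)); last 3 first.
  - by move=> i; exact: measurable_normX_le1.
  - by move=> i y; rewrite mulr_ge0 ?exprn_ge0.
  - by move=> i; exact: integral_normX_le1.
  rewrite integral_mkcond lp_ball_pinftyE//; apply: eq_integral => x _.
  rewrite patchE; case: ifPn => [|].
    rewrite inE/= => H; congr EFin; apply: eq_bigr => i _.
    by rewrite H mulr1.
  rewrite notin_setE/= => /existsNP[i /negP Hi].
  by rewrite (bigD1 i)//= (negbTE Hi) mulr0 mul0r.
have q0 : 0 < q by rewrite (lt_le_trans ltr01)// -lee_fin.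
set A := (\sum_i a i)%N; set M := (LHS).
rewrite /fine.
pose N (x : 'cV[R]_n) := \sum_i `|x i ord0| `^ q.
have N0 x : 0 <= N x by apply: sumr_ge0 => i _; exact: powR_ge0.
have mf : measurable_fun setT (fun x : 'cV[R]_n => (norm_monomial a x)%:E).
  by apply/measurable_EFinP; exact: measurable_norm_monomial.
have f0 (x : 'cV[R]_n) : (0 <= (norm_monomial a x)%:E)%E.
  by rewrite lee_fin norm_monomial_ge0.
have M0 : (0 <= M)%E by exact: integral_ge0.
(* The integral of the monomial times exp(-N) is evaluated twice: as a product over coordinates, and
   by layers as a Gamma value times the wanted moment M. *)
have := layer_cake_expRN (@lebesgue_cV R n) (measurable_sum_powR q) N0 mf f0.
have -> : (\int[lebesgue_cV]_x ((norm_monomial a x)%:E * (expR (- N x))%:E) =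
    (\prod_i (2 / (a i).+1%:R * Gamma (1 + (a i).+1%:R / q)))%:E)%E.
  rewrite -(@integral_cV_prod R n
    (fun i y => `|y| ^+ a i * expR (- (`|y| `^ q)))); last 3 first.
  - by move=> i; exact: measurable_normX_expRN.
  - by move=> i y; rewrite mulr_ge0 ?exprn_ge0 ?expR_ge0.
  - by move=> i; exact: integral_normX_expRN.
  apply: eq_integral => x _; rewrite -EFinM; congr EFin.
  by rewrite big_split/= /N -sumrN expR_sum.
have -> : (\int[lebesgue_measure]_(t in `]0%R, +oo[)
     ((expR (- t))%:E * \int[lebesgue_cV]_(x in [set x | (N x <= t)%R]) (norm_monomial a x)%:E) =
   (Gamma (1 + (n + A)%:R / q))%:E * M)%E.
  have G0 : 0 < 1 + (n + A)%:R / q by rewrite ltr_pwDl// divr_ge0// ltW.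
  rewrite GammaE// -ge0_integralZr//=; last 2 first.
  - exact: measurable_eGamma.
  - by move=> t _; rewrite lee_fin mulr_ge0 ?powR_ge0 ?expR_ge0.
  apply: eq_integral => t; rewrite inE/= in_itv/= andbT => t0.
  (* The layer at height t is a dilated ball, so its moment is t^((n + A)/q) M; the integral over t
     is then Gamma(1 + (n + A)/q) M. *)
  have -> : [set x | N x <= t] = lp_ball q%:E (t `^ q^-1).
    by rewrite lp_ball_EFinE ?powR_ge0// -powRrM mulVf ?gt_eqF// powRr1// ltW.
  rewrite integral_lp_ball_norm_monomial_scale ?powR_gt0//.
  rewrite muleA -EFinM mulrC addrAC subrr add0r -powR_mulrn ?powR_ge0//.
  by rewrite -powRrM [q^-1 * _]mulrC.
have G0 : 0 < Gamma (1 + (n + A)%:R / q).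
  by apply: Gamma_gt0; rewrite ltr_pwDl// divr_ge0// ltW.
move=> H; rewrite mulrC EFinM H muleA -EFinM mulVf ?gt_eqF// mul1e//.
Qed.

(** Isolates the growth of Gamma(k/q) as q tends to infinity in the factor q/k; the remaining factor
    tends to 1. *)
Lemma Gamma_div (R : realType) (k q : R) : 0 < k -> 0 < q ->
  Gamma (k / q) = q / k * Gamma (1 + k / q).
Proof.
move=> k0 q0; rewrite [1 + _]addrC GammaD1 ?divr_gt0//.
by field; rewrite !gt_eqF.
Qed.

(* At [p = +oo] the right-hand side uses [fine +oo = 0] and [k / 0 = 0], so
   that [Gamma (1 + k / fine p)] is [Gamma 1], its limit. *)
Lemma at_exponentE (R : realType) (F H : R -> R) (p : \bar R) : (1 <= p)%E ->
  (forall q, 0 < q -> F q = H q) -> H q @[q --> +oo] --> H 0 ->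
  at_exponent F p = H (fine p).
Proof.
case: p => [q||//] p1 FH Hoo /=.
  by rewrite FH// (lt_le_trans ltr01)// -lee_fin.
apply/cvg_lim => //; apply: cvg_trans Hoo; apply: near_eq_cvg.
by near=> q; rewrite FH//; near: q; exact: nbhs_pinfty_gt.
Unshelve. all: by end_near. Qed.

Lemma cvg_Gamma1D_div0 (R : realType) (a : R) : 0 <= a ->
  Gamma (1 + a / q) @[q --> +oo] --> Gamma (1 + a / 0).
Proof. by move=> a0; rewrite invr0 mulr0 addr0 Gamma1; exact: cvg_Gamma1D_div. Qed.

Lemma Gamma1D_div_gt0 (R : realType) (k q : R) : 0 <= k -> 0 <= q ->
  0 < Gamma (1 + k / q).
Proof. by move=> k0 q0; apply: Gamma_gt0; rewrite ltr_pwDl// divr_ge0. Qed.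

(** Three factors above and three below is the shape needed for I; for J and K the vacant places are
    filled with Gamma(1 + 0/q) = 1. *)
Lemma cvg_Gamma1D_ratio (R : realType) (x y z u v w : R) :
  0 <= x -> 0 <= y -> 0 <= z -> 0 <= u -> 0 <= v -> 0 <= w ->
  let H q := Gamma (1 + x / q) * Gamma (1 + y / q) * Gamma (1 + z / q) /
    (Gamma (1 + u / q) * Gamma (1 + v / q) * Gamma (1 + w / q)) in
  H q @[q --> +oo] --> H 0.
Proof.
move=> x0 y0 z0 u0 v0 w0 H; apply: cvgM.
  by do 2?[apply: cvgM]; exact: cvg_Gamma1D_div0.
apply: cvgV; last by do 2?[apply: cvgM]; exact: cvg_Gamma1D_div0.
by rewrite invr0 !mulr0 !addr0 Gamma1 !mulr1 oner_neq0.
Qed.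

(** * The coefficients, the volume and the monomial moments in terms of Gamma(1 + k/p) *)

Section coefficients.
Context {R : realType} (n : nat) (p : \bar R) (r : R).
Hypotheses (n0 : (0 < n)%N) (p1 : (1 <= p)%E).

Let G (k : R) : R := Gamma (1 + k / fine p).

Let G_gt0 (k : R) : 0 <= k -> 0 < G k.
Proof.
by move=> k0; apply: Gamma1D_div_gt0 => //; apply: fine_ge0; apply: le_trans p1.
Qed.

Let nN0 : n%:R != 0 :> R. Proof. by rewrite pnatr_eq0 -lt0n. Qed.

Let nD0 m : n%:R + m.+1%:R != 0 :> R.
Proof. by rewrite -natrD pnatr_eq0 addnS. Qed.

(** The right-hand side has the shape of the moment formula [integral_lp_ball_norm_monomial]: a
    factor [G (a + 1) / ((a + 1) * G 1)] for each coordinate of exponent a, here two coordinates of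
    exponent 2. *)
Lemma I_coefE : I_coef n p r =
  lp_volume n p * r ^+ (n + 4) *
  (G 3 / (3 * G 1) * (G 3 / (3 * G 1)) * (G n%:R / G (n + 4)%:R)).
Proof.
pose H q : R := Gamma (1 + 3 / q) * Gamma (1 + 3 / q) * Gamma (1 + n%:R / q) /
  (Gamma (1 + 1 / q) * Gamma (1 + 1 / q) * Gamma (1 + (n + 4)%:R / q)).
(* By [Gamma_div] the powers of q cancel: (q/3)^2 (q/n) / (q^2 q/(n + 4)) = (n + 4)/(9 n). The
   definition's own n/(n + 4) then leaves 1/9. *)
rewrite /I_coef (@at_exponentE _ _ (fun q => (n + 4)%:R / n%:R / 9 * H q))//.
- rewrite /H -!/(G _).
  have := G_gt0 (ler0n _ (n + 4)); have := G_gt0 (ler01 : 0 <= 1 :> R).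
  rewrite natrD; move: (G 1) (G _) (G 3) (G n%:R) => a b c d b0 a0.
  by field; rewrite nN0 nD0 !gt_eqF.
- move=> q q0; rewrite !Gamma_div// ?ltr0n ?addn_gt0 ?n0// /H natrD.
  have := Gamma1D_div_gt0 (ler01 : 0 <= 1 :> R) (ltW q0).
  have := Gamma1D_div_gt0 (ler0n _ (n + 4)) (ltW q0); rewrite natrD.
  move: (Gamma _) (Gamma (1 + 1 / q)) (Gamma (1 + 3 / q)) (Gamma (1 + n%:R / q)).
  move=> a b c d a0 b0.
  by field; rewrite nN0 nD0 !gt_eqF.
- by apply: cvgMl_tmp; exact: cvg_Gamma1D_ratio.
Qed.

Lemma J_coefE : J_coef n p r =
  lp_volume n p * r ^+ (n + 4) * (G 5 / (5 * G 1) * (G n%:R / G (n + 4)%:R)).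
Proof.
pose H q : R := Gamma (1 + 0 / q) * Gamma (1 + 5 / q) * Gamma (1 + n%:R / q) /
  (Gamma (1 + 0 / q) * Gamma (1 + 1 / q) * Gamma (1 + (n + 4)%:R / q)).
(* The constant is (q/5) (q/n) / (q q/(n + 4)). *)
rewrite /J_coef (@at_exponentE _ _ (fun q => (n + 4)%:R / n%:R / 5 * H q))//.
- rewrite /H mul0r addr0 Gamma1 -!/(G _).
  have := G_gt0 (ler0n _ (n + 4)); have := G_gt0 (ler01 : 0 <= 1 :> R).
  rewrite natrD; move: (G 1) (G _) (G 5) (G n%:R) => a b c d b0 a0.
  by field; rewrite nN0 nD0 !gt_eqF.
- move=> q q0; rewrite !Gamma_div// ?ltr0n ?addn_gt0 ?n0// /H mul0r addr0 Gamma1 natrD.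
  have := Gamma1D_div_gt0 (ler01 : 0 <= 1 :> R) (ltW q0).
  have := Gamma1D_div_gt0 (ler0n _ (n + 4)) (ltW q0); rewrite natrD.
  move: (Gamma _) (Gamma (1 + 1 / q)) (Gamma (1 + 5 / q)) (Gamma (1 + n%:R / q)).
  move=> a b c d a0 b0.
  by field; rewrite nN0 nD0 !gt_eqF.
- by apply: cvgMl_tmp; exact: cvg_Gamma1D_ratio.
Qed.

Lemma K_coefE : K_coef n p r =
  lp_volume n p * r ^+ (n + 2) * (G 3 / (3 * G 1) * (G n%:R / G (n + 2)%:R)).
Proof.
pose H q : R := Gamma (1 + 0 / q) * Gamma (1 + 3 / q) * Gamma (1 + n%:R / q) /
  (Gamma (1 + 0 / q) * Gamma (1 + 1 / q) * Gamma (1 + (n + 2)%:R / q)).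
rewrite /K_coef (@at_exponentE _ _ (fun q => (n + 2)%:R / n%:R / 3 * H q))//.
- rewrite /H mul0r addr0 Gamma1 -!/(G _).
  have := G_gt0 (ler0n _ (n + 2)); have := G_gt0 (ler01 : 0 <= 1 :> R).
  rewrite natrD; move: (G 1) (G _) (G 3) (G n%:R) => a b c d b0 a0.
  by field; rewrite nN0 nD0 !gt_eqF.
- move=> q q0; rewrite !Gamma_div// ?ltr0n ?addn_gt0 ?n0// /H mul0r addr0 Gamma1 natrD.
  have := Gamma1D_div_gt0 (ler01 : 0 <= 1 :> R) (ltW q0).
  have := Gamma1D_div_gt0 (ler0n _ (n + 2)) (ltW q0); rewrite natrD.
  move: (Gamma _) (Gamma (1 + 1 / q)) (Gamma (1 + 3 / q)) (Gamma (1 + n%:R / q)).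
  move=> a b c d a0 b0.
  by field; rewrite nN0 nD0 !gt_eqF.
- by apply: cvgMl_tmp; exact: cvg_Gamma1D_ratio.
Qed.

(** The moment of the constant monomial. *)
Lemma lp_volumeE : lp_volume n p = (2 * G 1) ^+ n / G n%:R.
Proof.
rewrite /lp_volume.
have := @integral_lp_ball1_norm_monomial R n p (fun=> 0%N) p1.
rewrite sum_nat_const muln0 addn0.
rewrite (eq_bigr (fun=> 2 * G 1)); last by move=> i _; rewrite divr1.
rewrite prodr_const card_ord -/(G _).
under eq_integral do rewrite /norm_monomial big1//.
rewrite integral_cst ?mul1e; last exact: measurable_lp_ball.
by move=> ->.
Qed.

Lemma integral_lp_ball_norm_monomial (a : 'I_n -> nat) : 0 < r ->
  (\int[lebesgue_cV]_(x in lp_ball p r) (norm_monomial a x)%:E =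
   (lp_volume n p * r ^+ (n + \sum_i a i) *
    (\prod_i (G (a i).+1%:R / ((a i).+1%:R * G 1)) *
     (G n%:R / G (n + \sum_i a i)%:R)))%:E)%E.
Proof.
move=> r0; rewrite integral_lp_ball_norm_monomial_scale//.
rewrite integral_lp_ball1_norm_monomial// -EFinM; congr EFin.
have G1 := G_gt0 (ler01 : 0 <= 1 :> R).
rewrite lp_volumeE -!/(G _).
(* A factor 2 G(1) is split off for each coordinate; together these form the numerator of the
   volume. *)
rewrite (eq_bigr (fun i =>
    2 * G 1 * (G (a i).+1%:R / ((a i).+1%:R * G 1)))); last first.
  by move=> i _; rewrite -/(G _); field; rewrite !gt_eqF.
rewrite big_split/= prodr_const card_ord.
have := G_gt0 (ler0n _ n); have := G_gt0 (ler0n _ (n + \sum_i a i)).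
move: (G 1 ) (G n%:R) (G _) (\prod_i _) => b c d e d0 c0.
by field; rewrite !gt_eqF.
Qed.

End coefficients.

(** * Integration over a ball *)

(** The integrand may change sign here, so the scaling lemma, with Jacobian 1, is applied to its
    positive and negative parts separately. *)
Lemma integral_cV_sign (R : realType) (n : nat) (s : 'I_n -> R)
    (f : 'cV[R]_n -> \bar R) :
  (forall i, `|s i| = 1) -> measurable_fun setT f ->
  (\int[lebesgue_cV]_x f (cV_scale s x) = \int[lebesgue_cV]_x f x)%E.
Proof.
move=> s1 mf.
have s0 i : s i != 0 by rewrite -normr_eq0 s1 oner_neq0.
have inv (h : 'cV[R]_n -> \bar R) : measurable_fun setT h -> (forall x, 0 <= h x)%E ->
    (\int[lebesgue_cV]_x h (cV_scale s x) = \int[lebesgue_cV]_x h x)%E.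
  move=> mh h0; rewrite (ge0_integral_cV_scale s0 mh h0).
  by rewrite big1 ?mul1e// => i _; rewrite s1 invr1.
rewrite [LHS]integralE [RHS]integralE; congr (_ - _)%E.
- rewrite -(inv f^\+%E (measurable_funepos mf)); last exact: funepos_ge0.
  by apply: eq_integral => x _; rewrite !(funeposE, funenegE).
- rewrite -(inv f^\-%E (measurable_funeneg mf)); last exact: funeneg_ge0.
  by apply: eq_integral => x _; rewrite !(funeposE, funenegE).
Qed.

Section ball_moments.
Context {R : realType} (n : nat) (p : \bar R) (r : R).
Hypotheses (n0 : (0 < n)%N) (p1 : (1 <= p)%E) (r0 : 0 < r).

Let G_gt0 (k : R) : 0 <= k -> 0 < Gamma (1 + k / fine p).
Proof.
by move=> k0; apply: Gamma1D_div_gt0 => //; apply: fine_ge0; apply: le_trans p1.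
Qed.

(** The factor of a coordinate with exponent 0 in the moment formula. *)
Let ratio1 : Gamma (1 + 1 / fine p) / (1 * Gamma (1 + 1 / fine p)) = 1.
Proof.
have := G_gt0 ler01; move: (Gamma _) => g g0.
by rewrite mul1r divff// gt_eqF.
Qed.

Definition ball_integral (f : 'cV[R]_n -> R) : R :=
  (\int[@lebesgue_cV R n]_(x in lp_ball p r) f x)%R.

Let L := ball_integral.

(** A class of integrable functions on the ball that contains the coordinates and is closed under
    sums and products, hence contains all polynomials. *)
Definition ball_bounded (f : 'cV[R]_n -> R) :=
  measurable_fun setT f /\ exists M, forall x, lp_ball p r x -> `|f x| <= M.

Lemma lebesgue_lp_ball : lebesgue_cV (@lp_ball R n p r) = (V_coef n p r)%:E.
Proof.
have := @integral_lp_ball_norm_monomial R n p r p1 (fun=> 0%N) r0.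
rewrite sum_nat_const muln0 addn0 big1//.
rewrite mul1r divff ?mulr1; last by rewrite gt_eqF// G_gt0.
move=> <-; under eq_integral do rewrite /norm_monomial big1//.
by rewrite integral_cst ?mul1e//; exact: measurable_lp_ball (ltW r0).
Qed.

Lemma ball_bounded_integrable f : ball_bounded f ->
  (@lebesgue_cV R n).-integrable (lp_ball p r) (EFin \o f).
Proof.
move=> [mf [M fM]]; apply: measurable_bounded_integrable.
- exact: measurable_lp_ball (ltW r0).
- apply: (@le_lt_trans _ _ (V_coef n p r)%:E); last exact: ltry.
  by rewrite -lebesgue_lp_ball; exact: lexx.
- exact: measurable_funTS.
- exists M; split; first exact: num_real.
  by move=> x Mx y /fM /le_trans; apply; exact: ltW.
Qed.

Lemma ball_bounded_cst c : ball_bounded (fun=> c).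
Proof. by split=> //; exists `|c| => x _. Qed.

Lemma ball_bounded_coord i : ball_bounded (fun x => x i ord0).
Proof.
split; first exact: measurable_cV_coord.
by exists r => x; exact: lp_ball_coord_le (ltW r0).
Qed.

Lemma ball_boundedD f g : ball_bounded f -> ball_bounded g ->
  ball_bounded (fun x => f x + g x).
Proof.
move=> [mf [M fM]] [mg [N gN]]; split; first exact: measurable_funD.
by exists (M + N) => x Bx; rewrite (le_trans (ler_normD _ _))// lerD ?fM ?gN.
Qed.

Lemma ball_boundedM f g : ball_bounded f -> ball_bounded g ->
  ball_bounded (fun x => f x * g x).
Proof.
move=> [mf [M fM]] [mg [N gN]]; split; first exact: measurable_funM.
by exists (M * N) => x Bx; rewrite normrM ler_pM ?fM ?gN.
Qed.

Lemma ball_bounded_sum (I : Type) (s : seq I) (f : I -> 'cV[R]_n -> R) :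
  (forall i, ball_bounded (f i)) -> ball_bounded (fun x => \sum_(i <- s) f i x).
Proof.
move=> bf; elim: s => [|i s IH].
  by under eq_fun do rewrite big_nil; exact: ball_bounded_cst.
by under eq_fun do rewrite big_cons; exact: ball_boundedD.
Qed.

Lemma ball_integralD f g : ball_bounded f -> ball_bounded g ->
  L (fun x => f x + g x) = L f + L g.
Proof.
by move=> bf bg; apply: RintegralD; [exact: measurable_lp_ball (ltW r0)| |];
  exact: ball_bounded_integrable.
Qed.

Lemma ball_integralZ c f : ball_bounded f -> L (fun x => c * f x) = c * L f.
Proof.
by move=> bf; apply: RintegralZl; [exact: measurable_lp_ball (ltW r0)|];
  exact: ball_bounded_integrable.
Qed.

Lemma ball_integral_cst c : L (fun=> c) = c * V_coef n p r.
Proof.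
rewrite /L /ball_integral Rintegral_cst; last exact: measurable_lp_ball (ltW r0).
congr (_ * _).
by have /(congr1 fine) := lebesgue_lp_ball.
Qed.

Lemma ball_integral_sum (I : Type) (s : seq I) (f : I -> 'cV[R]_n -> R) :
  (forall i, ball_bounded (f i)) ->
  L (fun x => \sum_(i <- s) f i x) = \sum_(i <- s) L (f i).
Proof.
move=> bf; elim: s => [|i s IH].
  rewrite big_nil (_ : (fun _ => _) = fun=> 0) ?ball_integral_cst ?mul0r//.
  by apply/funext => x; rewrite big_nil.
rewrite big_cons -IH -ball_integralD//; last exact: ball_bounded_sum.
by congr L; apply/funext => x; rewrite big_cons.
Qed.

(** Sign flips preserve both the measure and the ball, so the integral of f equals its own
    negative. *)
Lemma ball_integral_odd (s : 'I_n -> R) f : ball_bounded f ->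
  (forall i, `|s i| = 1) -> (forall x, f (cV_scale s x) = - f x) -> L f = 0.
Proof.
move=> bf s1 fs.
have mF : measurable_fun setT ((EFin \o f) \_ (lp_ball p r)).
  apply/(measurable_restrictT _ (measurable_lp_ball p1 (ltW r0))).
  by apply/measurable_funTS/measurable_EFinP; case: bf.
have H : L (fun x => -1 * f x) = L f.
  rewrite /L /ball_integral /Rintegral; congr fine.
  rewrite integral_mkcond [RHS]integral_mkcond -[RHS](integral_cV_sign s1 mF).
  apply: eq_integral => x _; rewrite !patchE.
  have -> : (cV_scale s x \in lp_ball p r) = (x \in lp_ball p r).
    by apply/idP/idP; rewrite !inE /lp_ball/= lp_norm_sign.
  by case: ifPn => // _; rewrite /= fs mulN1r.
by move: H; rewrite ball_integralZ//; lra.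
Qed.

Lemma ball_integral_norm_monomial (a : 'I_n -> nat) (f : 'cV[R]_n -> R) :
  (forall x, f x = norm_monomial a x) ->
  L f = lp_volume n p * r ^+ (n + \sum_i a i) *
    (\prod_i (Gamma (1 + (a i).+1%:R / fine p) /
              ((a i).+1%:R * Gamma (1 + 1 / fine p))) *
     (Gamma (1 + n%:R / fine p) / Gamma (1 + (n + \sum_i a i)%:R / fine p))).
Proof.
move=> fE; rewrite /L /ball_integral /Rintegral.
under eq_integral do rewrite fE.
by rewrite integral_lp_ball_norm_monomial.
Qed.

Let flip (i j : 'I_n) : R := if j == i then -1 else 1.

Let norm_flip i j : `|flip i j| = 1.
Proof. by rewrite /flip; case: eqP; rewrite ?normrN normr1. Qed.

Let prod_delta2 (F : nat -> R) (i j : 'I_n) : F 0%N = 1 -> i != j ->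
  \prod_k F ((k == i) * 2 + (k == j) * 2)%N = F 2%N * F 2%N.
Proof.
move=> F0 ij; have ji : j != i by rewrite eq_sym.
rewrite (bigD1 i)//= (bigD1 j)//= !eqxx (negbTE ij) (negbTE ji) big1 ?mulr1//.
by move=> k /andP[/negbTE -> /negbTE ->].
Qed.

Let sum_delta2 (i j : 'I_n) : (\sum_k ((k == i) * 2 + (k == j) * 2))%N = 4%N.
Proof.
have sum_delta (l : 'I_n) : (\sum_k (k == l) * 2)%N = 2%N.
  by rewrite (bigD1 l)//= eqxx big1 ?addn0// => k /negbTE ->.
by rewrite big_split/= !sum_delta.
Qed.

(** The exponents are those of 2 e_i + 2 e_j, which is 4 e_i when i = j; the same monomial thus
    yields both I and J. *)
Let norm_monomial_delta2 (i j : 'I_n) (x : 'cV[R]_n) :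
  norm_monomial (fun k => (k == i) * 2 + (k == j) * 2)%N x =
  x i ord0 ^+ 2 * x j ord0 ^+ 2.
Proof.
have prod_delta l : \prod_k `|x k ord0| ^+ ((k == l) * 2) = x l ord0 ^+ 2.
  rewrite (bigD1 l)//= eqxx mul1n real_normK ?num_real// big1 ?mulr1//.
  by move=> k /negbTE ->.
rewrite /norm_monomial; under eq_bigr do rewrite exprD.
by rewrite big_split/= !prod_delta.
Qed.

Lemma ball_integral_coord2 i j :
  L (fun x => x i ord0 * x j ord0) = K_coef n p r * (i == j)%:R.
Proof.
have b2 : ball_bounded (fun x => x i ord0 * x j ord0).
  by apply: ball_boundedM; exact: ball_bounded_coord.
have [<-|ij] := eqVneq i j; last first.
  rewrite mulr0; apply: (ball_integral_odd b2 (norm_flip i)) => x.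
  by rewrite !mxE /flip eqxx eq_sym (negbTE ij) mulN1r mul1r mulNr.
rewrite mulr1 (@ball_integral_norm_monomial (fun k => (k == i) * 2)%N); last first.
  move=> x; rewrite /norm_monomial (bigD1 i)//= eqxx mul1n big1 ?mulr1.
    by rewrite real_normK ?num_real.
  by move=> k /negbTE ->.
have -> : (\sum_k (k == i) * 2)%N = 2%N.
  by rewrite (bigD1 i)//= eqxx big1 ?addn0// => k /negbTE ->.
rewrite K_coefE//; congr (_ * (_ * _)).
by rewrite (bigD1 i)//= eqxx mul1n big1 ?mulr1// => k /negbTE ->.
Qed.

Lemma ball_integral_sq2 i j :
  L (fun x => x i ord0 ^+ 2 * x j ord0 ^+ 2) =
  if i == j then J_coef n p r else I_coef n p r.
Proof.
rewrite (ball_integral_norm_monomial (fun x => esym (norm_monomial_delta2 i j x))).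
rewrite sum_delta2; case: eqVneq => [<-|ij].
  rewrite J_coefE//; congr (_ * (_ * _)).
  by rewrite (bigD1 i)//= eqxx big1 ?mulr1// => k /negbTE ->.
rewrite I_coefE//; congr (_ * (_ * _)).
by rewrite (prod_delta2 (F := fun k => Gamma (1 + k.+1%:R / fine p) /
  (k.+1%:R * Gamma (1 + 1 / fine p)))).
Qed.

(** The integral vanishes unless the four indices pair up. Two distinct pairs select exactly one
    product of deltas, giving I; when all indices coincide the first bracket is 3 and the correction
    J - 3 I restores J. *)
Lemma ball_integral_coord4 i j k l :
  L (fun x => x i ord0 * x j ord0 * x k ord0 * x l ord0) =
  I_coef n p r * ((i == j)%:R * (k == l)%:R + (i == k)%:R * (j == l)%:R +
                  (i == l)%:R * (j == k)%:R) +
  (J_coef n p r - 3 * I_coef n p r) * ((i == j)%:R * (j == k)%:R * (k == l)%:R).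
Proof.
have b4 : ball_bounded (fun x => x i ord0 * x j ord0 * x k ord0 * x l ord0).
  by do 3?[apply: ball_boundedM]; exact: ball_bounded_coord.
(* If m occurs an odd number of times among the indices, reflecting the coordinate m changes the
   sign of the integrand. *)
have odd m : (m == i) (+) (m == j) (+) (m == k) (+) (m == l) ->
    L (fun x => x i ord0 * x j ord0 * x k ord0 * x l ord0) = 0.
  move=> modd; apply: (ball_integral_odd b4 (norm_flip m)) => x.
  rewrite !mxE /flip ![_ == m]eq_sym; move: modd.
  by case: (m == i); case: (m == j); case: (m == k); case: (m == l) => //= _; ring.
have sq (a b : 'I_n) (f : 'cV[R]_n -> R) :
    (forall x, f x = x a ord0 ^+ 2 * x b ord0 ^+ 2) ->
    L f = if a == b then J_coef n p r else I_coef n p r.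
  by move=> fE; rewrite -ball_integral_sq2; congr L; apply/funext.
have [ij|ij] := eqVneq i j; have [kl|kl] := eqVneq k l.
- subst j l; rewrite (sq i k); last by move=> x; ring.
  have [ik|ik] := eqVneq i k; first by subst k; rewrite ?eqxx /=; ring.
  by rewrite ?eqxx ?(negbTE ik) /=; ring.
- subst j; have [ik|ik] := eqVneq i k.
    subst k; rewrite (odd l) ?(negbTE kl) ?eqxx ?[l == i]eq_sym ?(negbTE kl) ?eqxx//.
    by rewrite ?eqxx /=; ring.
  rewrite (odd k) ?eqxx ?[k == i]eq_sym ?(negbTE ik) ?(negbTE kl)//.
  by rewrite ?eqxx /=; ring.
- subst l; have [ik|ik] := eqVneq i k.
    subst k; rewrite (odd j) ?eqxx ?[j == i]eq_sym ?(negbTE ij)//.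
    by rewrite ?eqxx /=; ring.
  rewrite (odd i) ?eqxx ?(negbTE ik) ?(negbTE ij)//.
  by rewrite ?eqxx /=; ring.
- have [ik|ik] := eqVneq i k.
    subst k; have [jl|jl] := eqVneq j l.
      subst l; rewrite (sq i j) ?(negbTE ij); last by move=> x; ring.
      by rewrite ?eqxx /=; ring.
    rewrite (odd j) ?eqxx ?[j == i]eq_sym ?(negbTE ij) ?(negbTE jl)//.
    by rewrite ?eqxx /=; ring.
  have [il|il] := eqVneq i l.
    subst l; have [jk|jk] := eqVneq j k.
      subst k; rewrite (sq i j) ?(negbTE ij); last by move=> x; ring.
      by rewrite ?eqxx /=; ring.
    rewrite (odd j) ?eqxx ?[j == i]eq_sym ?(negbTE ij) ?(negbTE jk)//.
    by rewrite ?eqxx /=; ring.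
  rewrite (odd i) ?eqxx ?(negbTE ij) ?(negbTE ik) ?(negbTE il)//.
  by rewrite ?eqxx /=; ring.
Qed.

End ball_moments.

(** * Quadratics *)

Section quadratic_moments.
Context {R : realType} (n : nat) (p : \bar R) (r : R).
Hypotheses (n0 : (0 < n)%N) (p1 : (1 <= p)%E) (r0 : 0 < r).

Let L := @ball_integral R n p r.
Let bounded := @ball_bounded R n p r.
Let I := I_coef n p r.
Let J := J_coef n p r.
Let K := K_coef n p r.
Let V := V_coef n p r.

(** The coefficients form a function rather than a vector, so that a row [A i] of a matrix can be
    passed directly. *)
Definition linear_form (b : 'I_n -> R) (x : 'cV[R]_n) : R :=
  \sum_i b i * x i ord0.

Definition quadratic_form (A : 'M[R]_n) (x : 'cV[R]_n) : R :=
  \sum_i \sum_j A i j * (x i ord0 * x j ord0).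

Lemma quadraticE (A : 'M[R]_n) (g : 'cV[R]_n) (c : R) (x : 'cV[R]_n) :
  quadratic A g c x =
  2^-1 * quadratic_form A x + linear_form (fun i => g i ord0) x + c.
Proof.
rewrite /quadratic; congr (_ * _ + _ + _).
  rewrite -mulmxA mxE; apply: eq_bigr => i _; rewrite !mxE mulr_sumr.
  by apply: eq_bigr => j _; ring.
by rewrite mxE; apply: eq_bigr => i _; rewrite mxE.
Qed.

Lemma ball_bounded_coord2 i j : bounded (fun x => x i ord0 * x j ord0).
Proof. by apply: ball_boundedM; exact: ball_bounded_coord. Qed.

Lemma ball_boundedZ c f : bounded f -> bounded (fun x => c * f x).
Proof. by move=> bf; apply: ball_boundedM => //; exact: ball_bounded_cst. Qed.

Lemma ball_bounded_linear_form b : bounded (linear_form b).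
Proof.
by apply: ball_bounded_sum => i; apply: ball_boundedZ; exact: ball_bounded_coord.
Qed.

Lemma ball_bounded_quadratic_form A : bounded (quadratic_form A).
Proof.
by apply: ball_bounded_sum => i; apply: ball_bounded_sum => j; apply: ball_boundedZ;
  exact: ball_bounded_coord2.
Qed.

Let sum_delta (F : 'I_n -> R) i : \sum_j F j * (i == j)%:R = F i.
Proof.
rewrite (bigD1 i)//= eqxx mulr1 big1 ?addr0// => j; rewrite eq_sym => /negbTE ->.
by rewrite mulr0.
Qed.

Lemma ball_integral_quadratic_form A : L (quadratic_form A) = K * \tr A.
Proof.
rewrite /L ball_integral_sum//; last first.
  by move=> i; apply: ball_bounded_sum => j; apply: ball_boundedZ; exact: ball_bounded_coord2.
rewrite mulr_sumr; apply: eq_bigr => i _.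
rewrite ball_integral_sum//; last first.
  by move=> j; apply: ball_boundedZ; exact: ball_bounded_coord2.
rewrite -(sum_delta (fun j => K * A i j)); apply: eq_bigr => j _.
rewrite ball_integralZ//; last exact: ball_bounded_coord2.
by rewrite ball_integral_coord2// /K; ring.
Qed.

Lemma ball_integral_linear_form b : L (linear_form b) = 0.
Proof.
apply: (ball_integral_odd p1 r0 (ball_bounded_linear_form b) (s := fun=> -1)).
  by move=> _; rewrite normrN normr1.
move=> x; rewrite /linear_form -sumrN; apply: eq_bigr => i _.
by rewrite mxE; ring.
Qed.

(** The product is the quadratic form of a rank-one matrix, whose trace is the scalar product of b
    and b'. *)
Lemma ball_integral_linear_formM b b' :
  L (fun x => linear_form b x * linear_form b' x) = K * \sum_i b i * b' i.
Proof.
pose A := \matrix_(i, j) (b i * b' j).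
transitivity (L (quadratic_form A)).
  congr L; apply/funext => x; rewrite /linear_form big_distrlr/=.
  by apply: eq_bigr => i _; apply: eq_bigr => j _; rewrite mxE; ring.
rewrite ball_integral_quadratic_form; congr (_ * _).
by apply: eq_bigr => i _; rewrite mxE.
Qed.

(** The integrand has degree three, so it is odd under x -> -x. *)
Lemma ball_integral_quadratic_linear A b :
  L (fun x => quadratic_form A x * linear_form b x) = 0.
Proof.
have bd : bounded (fun x => quadratic_form A x * linear_form b x).
  by apply: ball_boundedM; [exact: ball_bounded_quadratic_form|exact: ball_bounded_linear_form].
apply: (ball_integral_odd p1 r0 bd (s := fun=> -1)).
  by move=> _; rewrite normrN normr1.
move=> x; rewrite -mulrN; congr (_ * _).
  by apply: eq_bigr => i _; apply: eq_bigr => j _; rewrite !mxE; ring.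
rewrite /linear_form -sumrN; apply: eq_bigr => i _.
by rewrite mxE; ring.
Qed.

(** Contraction of the fourth moments with A twice: the pairing (ij)(kl) gives the squared trace,
    the two crossed pairings each give the squared Frobenius norm by symmetry, and the quadruple
    delta gives the diagonal. *)
Lemma ball_integral_quadratic_form_sq A : A^T = A ->
  L (fun x => quadratic_form A x * quadratic_form A x) =
  I * ((\tr A) ^+ 2 + 2 * \sum_i \sum_j A i j ^+ 2) +
  (J - 3 * I) * \sum_i A i i ^+ 2.
Proof.
move=> AT; have Asym i j : A j i = A i j by rewrite -[in RHS]AT mxE.
have b4 i j k l : bounded (fun x => x i ord0 * x j ord0 * x k ord0 * x l ord0).
  by do 3?[apply: ball_boundedM]; exact: ball_bounded_coord.
transitivity (\sum_i \sum_j \sum_k \sum_l (A i j * A k l) *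
    L (fun x => x i ord0 * x j ord0 * x k ord0 * x l ord0)).
  transitivity (L (fun x : 'cV[R]_n => \sum_i \sum_j \sum_k \sum_l (A i j * A k l) *
     (x i ord0 * x j ord0 * x k ord0 * x l ord0))).
    congr L; apply/funext => x; rewrite {1}/quadratic_form mulr_suml.
    apply: eq_bigr => i _; rewrite mulr_suml; apply: eq_bigr => j _.
    rewrite /quadratic_form mulr_sumr; apply: eq_bigr => k _.
    by rewrite mulr_sumr; apply: eq_bigr => l _; ring.
  rewrite /L ball_integral_sum//; last first.
    by move=> i; do 3?[apply: ball_bounded_sum => ?]; exact: ball_boundedZ.
  apply: eq_bigr => i _; rewrite ball_integral_sum//; last first.
    by move=> j; do 2?[apply: ball_bounded_sum => ?]; exact: ball_boundedZ.
  apply: eq_bigr => j _; rewrite ball_integral_sum//; last first.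
    by move=> k; apply: ball_bounded_sum => ?; exact: ball_boundedZ.
  apply: eq_bigr => k _; rewrite ball_integral_sum//; last first.
    by move=> l; exact: ball_boundedZ.
  by apply: eq_bigr => l _; apply: ball_integralZ => //; exact: b4.
have S i j : \sum_k \sum_l (A i j * A k l) *
      L (fun x => x i ord0 * x j ord0 * x k ord0 * x l ord0) =
    I * \tr A * (A i j * (i == j)%:R) + 2 * I * A i j ^+ 2 +
    (J - 3 * I) * A i j ^+ 2 * (i == j)%:R.
  transitivity (\sum_k (I * (i == j)%:R * A i j * A k k +
     I * A i j * A k j * (i == k)%:R + I * A i j * A k i * (j == k)%:R +
     (J - 3 * I) * (i == j)%:R * A i j * A k k * (j == k)%:R)).
    apply: eq_bigr => k _.
    (* Each of the four terms is re-expanded as a sum over l against a delta, at l = k, j, i, k in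
       turn, so that both sides can be compared termwise. *)
    rewrite -(sum_delta (fun l => I * (i == j)%:R * A i j * A k l) k).
    rewrite -(sum_delta (fun l => I * A i j * A k l * (i == k)%:R) j).
    rewrite -(sum_delta (fun l => I * A i j * A k l * (j == k)%:R) i).
    rewrite -(sum_delta (fun l => (J - 3 * I) * (i == j)%:R * A i j * A k l * (j == k)%:R) k).
    rewrite -!big_split/=; apply: eq_bigr => l _.
    by rewrite /L ball_integral_coord4// -/I -/J; ring.
  rewrite !big_split/= -!mulr_sumr.
  rewrite !sum_delta -/(\tr A) (Asym i j).
  by case: eqVneq => [<-|_] /=; ring.
transitivity (\sum_i (I * \tr A * A i i + 2 * I * \sum_j A i j ^+ 2 +
    (J - 3 * I) * A i i ^+ 2)).
  apply: eq_bigr => i _; under eq_bigr do rewrite S.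
  rewrite !big_split/= -!mulr_sumr sum_delta; congr (_ + _).
  by rewrite -[RHS](sum_delta (fun j => (J - 3 * I) * A i j ^+ 2)).
by rewrite !big_split/= -!mulr_sumr -/(\tr A); ring.
Qed.

(** With quadratic part q/2 and linear part l, the square is q^2/4 + q l + l^2 + c q + 2 c l + c^2.
    The odd terms q l and 2 c l integrate to 0, and q^2/4 produces the coefficients I/2, I/4 and (J
    - 3 I)/4. *)
Lemma ball_integral_quadratic_sq A (g : 'cV[R]_n) c : A^T = A ->
  L (fun x => quadratic A g c x * quadratic A g c x) =
  I / 2 * (\sum_i \sum_j A i j ^+ 2) + I / 4 * (\tr A) ^+ 2 +
  (J - 3 * I) / 4 * (\sum_i A i i ^+ 2) +
  K * (c * \tr A + \sum_i g i ord0 ^+ 2) + V * c ^+ 2.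
Proof.
move=> AT; set l := linear_form (fun i => g i ord0); set q := quadratic_form A.
have bq : bounded q by exact: ball_bounded_quadratic_form.
have bl : bounded l by exact: ball_bounded_linear_form.
have bqq : bounded (fun x => q x * q x) by exact: ball_boundedM.
have bll : bounded (fun x => l x * l x) by exact: ball_boundedM.
have bql : bounded (fun x => q x * l x) by exact: ball_boundedM.
have bc k : bounded (fun=> k) by exact: ball_bounded_cst.
transitivity (L (fun x => 4^-1 * (q x * q x) + (q x * l x + (l x * l x +
    (c * q x + (2 * c * l x + c ^+ 2)))))).
  by congr L; apply/funext => x; rewrite quadraticE -/l -/q; field.
rewrite /L !ball_integralD//; do ?[apply: ball_boundedD|exact: ball_boundedZ|by []].
rewrite ball_integral_cst// !ball_integralZ//.
rewrite -!/(L _) ball_integral_quadratic_form_sq// ball_integral_quadratic_linear.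
rewrite ball_integral_linear_formM ball_integral_quadratic_form.
have -> : \sum_i g i ord0 ^+ 2 = \sum_i g i ord0 * g i ord0.
  by apply: eq_bigr => i _; rewrite expr2.
by rewrite ball_integral_linear_form -/V; field.
Qed.

(** Meant for the components of the gradient, with b a row of the matrix and d an entry of g. *)
Lemma ball_integral_affine_sq (b : 'I_n -> R) d :
  L (fun x => (linear_form b x + d) * (linear_form b x + d)) =
  K * (\sum_i b i ^+ 2) + V * d ^+ 2.
Proof.
have bl : bounded (linear_form b) by exact: ball_bounded_linear_form.
have bll : bounded (fun x => linear_form b x * linear_form b x).
  exact: ball_boundedM.
have bc k : bounded (fun=> k) by exact: ball_bounded_cst.
transitivity (L (fun x => linear_form b x * linear_form b x +
    (2 * d * linear_form b x + d ^+ 2))).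
  by congr L; apply/funext => x; ring.
rewrite /L !ball_integralD//; do ?[apply: ball_boundedD|exact: ball_boundedZ|by []].
rewrite ball_integral_cst// !ball_integralZ//.
rewrite -!/(L _) ball_integral_linear_formM ball_integral_linear_form -/V.
have -> : \sum_i b i ^+ 2 = \sum_i b i * b i.
  by apply: eq_bigr => i _; rewrite expr2.
by ring.
Qed.

End quadratic_moments.

(** * The gradient of a quadratic, the norms in coordinates, and the two identities *)

Lemma linear_form_shift (R : realType) (n : nat) (b : 'I_n -> R) (h : R)
    (i : 'I_n) (x : 'cV[R]_n) :
  linear_form b (h *: delta_mx i ord0 + x) = linear_form b x + h * b i.
Proof.
rewrite /linear_form (bigD1 i)//= [in RHS](bigD1 i)//= !mxE !eqxx/=.
under eq_bigr => j /negbTE ji do rewrite !mxE ji mulr0 add0r.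
by ring.
Qed.

(** Nested linear forms reduce the effect of a shift along a basis vector to [linear_form_shift]. *)
Lemma quadratic_formE (R : realType) (n : nat) (A : 'M[R]_n) (x : 'cV[R]_n) :
  quadratic_form A x = linear_form (fun k => linear_form (A k) x) x.
Proof.
apply: eq_bigr => k _; rewrite /linear_form mulr_suml; apply: eq_bigr => l _.
by ring.
Qed.

Lemma gradient_quadratic (R : realType) (n : nat) (A : 'M[R]_n) (g : 'cV[R]_n)
    (c : R) (x : 'cV[R]_n) (i : 'I_n) : A^T = A ->
  gradient (quadratic A g c) x i ord0 = linear_form (A i) x + g i ord0.
Proof.
move=> AT; rewrite mxE; set d := (RHS); rewrite /derive; apply/cvg_lim => //.
have Asym k l : A l k = A k l by rewrite -[in RHS]AT mxE.
(* Exact second-order expansion along e_i, in which symmetry merges the two cross terms. The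
   difference quotient is therefore d + h A_ii / 2, with limit d. *)
have key h : quadratic A g c (h *: delta_mx i ord0 + x) =
    quadratic A g c x + (h * d + h ^+ 2 * (2^-1 * A i i)).
  rewrite !quadraticE !quadratic_formE !linear_form_shift.
  have -> : linear_form (fun k => linear_form (A k) (h *: delta_mx i ord0 + x)) x =
      linear_form (fun k => linear_form (A k) x) x + h * linear_form (A i) x.
    rewrite /linear_form mulr_sumr -big_split/=; apply: eq_bigr => k _.
    by rewrite -/(linear_form _ _) linear_form_shift Asym /linear_form; ring.
  by rewrite /d; field.
have : d + h * (2^-1 * A i i) @[h --> (0 : R)^'] --> d + 0 * (2^-1 * A i i).
  apply: cvgD; first exact: cvg_cst.
  by apply: cvgMr_tmp; apply: (@cvg_within_filter _ _ id); exact: cvg_id.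
rewrite mul0r addr0 => lim_d.
apply: cvg_trans lim_d; apply: near_eq_cvg; near=> h.
have h0 : h != 0 by near: h; exact: nbhs_dnbhs_neq.
by rewrite /= key /GRing.scale/=; field.
Unshelve. all: by end_near. Qed.

Lemma frobenius_norm_sq (R : realType) (n : nat) (A : 'M[R]_n) :
  frobenius_norm A ^+ 2 = \sum_i \sum_j A i j ^+ 2.
Proof.
rewrite sqr_sqrtr//; apply: sumr_ge0 => i _; apply: sumr_ge0 => j _.
exact: sqr_ge0.
Qed.

Lemma frobenius_norm_diagonal_part_sq (R : realType) (n : nat) (A : 'M[R]_n) :
  frobenius_norm (diagonal_part A) ^+ 2 = \sum_i A i i ^+ 2.
Proof.
rewrite frobenius_norm_sq; apply: eq_bigr => i _.
rewrite (bigD1 i)//= big1 ?addr0 => [|j ij].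
  by rewrite !mxE eqxx.
by rewrite !mxE eq_sym (negbTE ij) mulr0n expr0n.
Qed.

Lemma lp_norm2_sq (R : realType) (n : nat) (x : 'cV[R]_n) :
  lp_norm 2%:E x ^+ 2 = \sum_i x i ord0 ^+ 2.
Proof.
have E : \sum_i `|x i ord0| `^ 2 = \sum_i x i ord0 ^+ 2.
  apply: eq_bigr => i _; rewrite powR_mulrn//.
  by rewrite real_normK ?num_real.
rewrite /lp_norm E powR12_sqrt ?sqr_sqrtr//; apply: sumr_ge0 => i _;
  exact: sqr_ge0.
Qed.

Lemma sqr_poweR12 (R : realType) (x : R) : 0 <= x ->
  ((x%:E `^ 2^-1) ^+ 2 = x%:E)%E.
Proof.
by move=> x0; rewrite poweR_EFin -EFin_expe powR12_sqrt// sqr_sqrtr.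
Qed.

Theorem theorem3p1 (R : realType) (n : nat) (r : R) (p : \bar R)
    (B : 'M[R]_n) (g : 'cV[R]_n) (c : R)
    (hn : (1 <= n)%N) (hr : 0 < r) (hp : (1 <= p)%E) (hB : B^T = B) :
  let Q := quadratic B g c in
  let D := diagonal_part B in
  let I := I_coef n p r in
  let J := J_coef n p r in
  let K := K_coef n p r in
  let V := V_coef n p r in
  (H0_norm (lp_ball p r) Q ^+ 2)%E =
    (I / 2 * frobenius_norm B ^+ 2 + I / 4 * (\tr B) ^+ 2
     + (J - 3 * I) / 4 * frobenius_norm D ^+ 2
     + K * (c * \tr B + lp_norm 2%:E g ^+ 2) + V * c ^+ 2)%:E /\
  (H1_seminorm (lp_ball p r) Q ^+ 2)%E =
    (K * frobenius_norm B ^+ 2 + V * lp_norm 2%:E g ^+ 2)%:E.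
Proof.
move=> Q D I J K V.
(* Both norms are defined by extended-real integrals; finiteness allows passing to the real-valued
   integral, where linearity was established. *)
have EFin_ball_integral f : ball_bounded p r f ->
    (\int[lebesgue_cV]_(x in lp_ball p r) (f x)%:E)%E = (ball_integral p r f)%:E.
  move=> /(ball_bounded_integrable hp hr) bf.
  rewrite /ball_integral /Rintegral fineK//.
  by apply: integrable_fin_num => //; exact: measurable_lp_ball (ltW hr).
have int_ge0 f : (forall x, 0 <= f x) -> 0 <= @ball_integral R n p r f.
  by move=> f0; apply: Rintegral_ge0 => x _; exact: f0.
have bQ : ball_bounded p r Q.
  rewrite (funext (quadraticE B g c) : Q = _).
  apply: ball_boundedD; last exact: ball_bounded_cst.
  apply: ball_boundedD; last exact: ball_bounded_linear_form.
  by apply: ball_boundedZ; exact: ball_bounded_quadratic_form.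
rewrite frobenius_norm_sq frobenius_norm_diagonal_part_sq lp_norm2_sq; split.
  rewrite /H0_norm; under eq_integral do rewrite real_normK ?num_real//.
  under eq_integral do rewrite expr2.
  rewrite EFin_ball_integral; last exact: ball_boundedM.
  rewrite sqr_poweR12; first by rewrite ball_integral_quadratic_sq.
  by apply: int_ge0 => x; rewrite -expr2 sqr_ge0.
pose l i x := linear_form (B i) x + g i ord0.
have bl i : ball_bounded p r (l i).
  by apply: ball_boundedD; [exact: ball_bounded_linear_form|exact: ball_bounded_cst].
rewrite /H1_seminorm.
(* The squared gradient norm is a sum of squares of affine functions, integrated one component at a
   time. *)
have E x : lp_norm 2%:E (gradient Q x) ^+ 2 = \sum_i l i x * l i x.
  rewrite lp_norm2_sq; apply: eq_bigr => i _.
  by rewrite gradient_quadratic// expr2.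
under eq_integral do rewrite E.
rewrite EFin_ball_integral; last first.
  by apply: ball_bounded_sum => i; exact: ball_boundedM.
rewrite sqr_poweR12; last first.
  by apply: int_ge0 => x; apply: sumr_ge0 => i _; rewrite -expr2 sqr_ge0.
rewrite ball_integral_sum//; last by move=> i; exact: ball_boundedM.
congr EFin; rewrite !mulr_sumr -big_split/=; apply: eq_bigr => i _.
by rewrite ball_integral_affine_sq.
Qed.
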